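(* Let $R$ be a complete discrete valuation ring with perfect residue field $k$ of characteristic $p>2$, with uniformizer $\pi$, and with field of fractions $K$ of characteristic $0$; let $\bar K$ be an algebraic closure of $K$. Let $E$ be the elliptic curve over $K$ given by $y^2=x(x-a)(x-b)$ with $a,b\in R^*$ and $a\not\equiv b \bmod \pi$. Let $G\subseteq E[p](\bar K)$ be a subgroup with $\#G=p$ which is defined over $K$ (i.e. $\sigma(G)=G$ for all $\sigma\in\mathrm{Gal}(\bar K/K)$) and which is contained in the kernel of reduction. Let $h(x), g_1(x),g_2(x),g_3(x)\in K[x]$ be the polynomials attached to $G$ in the context. Let $E^{(p)}$ be defined by $$y^2=x\,(x-a^{(p)})(x-b^{(p)}),\qquad a^{(p)}=a^p\left(\frac{h(b)}{h(a)}\right)^2,\quad b^{(p)}=b^p\left(\frac{h(a)}{h(b)}\right)^2 .$$ Then: 1. $E^{(p)}$ is a non-singular elliptic curve, and there exists an isogeny $F:E\to E^{(p)}$ given by $$(x,y)\mapsto\left(\frac{x\cdot g_1(x)^2}{h(x)^2},\ \frac{\prod_{i=1}^3 g_i(x)}{h(x)^3}\cdot y\right),$$ which has kernel $G$. 2. $a^{(p)},b^{(p)}\in R$ and $h(x),g_i(x)\in R[x]$ for $i=1,2,3$. 3. The curve $E^{(p)}$ reduces to $\bar E^{(p)}$, and the isogeny $F$ lifts the relative Frobenius $\bar F:\bar E\to\bar E^{(p)}$. 4. $F^*\left(\frac{dx}{y}\right)=\mathrm{lead}(h)\cdot\frac{dx}{y}$, where $\mathrm{lead}(h)$ denotes the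 leading coefficient of $h(x)$.
   Context: Notation. $\bar a,\bar b\in k$ are the reductions of $a,b$ modulo $\pi$. The reduction of $E$ is $\bar E: y^2=x(x-\bar a)(x-\bar b)$ over $k$, and $\bar E^{(p)}$ is the elliptic curve $y^2=x(x-\bar a^p)(x-\bar b^p)$ over $k$. The relative Frobenius morphism $\bar F:\bar E\to\bar E^{(p)}$ is the isogeny $(x,y)\mapsto(x^p,y^p)$. A point of $E(\bar K)$ lies in the kernel of reduction if it reduces to the zero point of $\bar E$; for a point $Q\neq 0_E$ this means that $x(Q)$ has negative valuation, for the unique extension to $\bar K$ of the valuation of $K$. Polynomials attached to $G$. For $0_E\ne Q\in E(\bar K)$ let $x(Q)$ be its $x$-coordinate. Put $P_1=(0,0)$, $P_2=(a,0)$, $P_3=(b,0)$. Choose $S\subseteq G$ with $S\cap -S=\emptyset$ and $G=S\cup -S\cup\{0_E\}$, where $0_E$ is the zero point of $E$. Define $$h(x)=\prod_{Q\in S}\left(1-\frac{x}{x(Q)}\right),\qquad g_i(x)=\prod_{Q\in S}\big(x-x(Q+P_i)\big),\quad i=1,2,3.$$ (Here $x(Q)\neq 0$ for $Q\in S$ because $p>2$; the polynomials lie in $K[x]$ because $G$ is defined over $K$, and they do not depend on the choice of $S$.) *)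

(* Defs.v *)
From HB Require Import structures.
From mathcomp Require Import all_boot all_order all_algebra.
From mathcomp Require Import finmap.
From mathcomp.multinomials Require Import mpoly.

Set Implicit Arguments.
Unset Strict Implicit.
Unset Printing Implicit Defensive.

Import Order.TTheory GRing.Theory Num.Theory.

Local Open Scope ring_scope.

Section DiscreteValuationRings.
Variables (R : idomainType) (pi : R).

Definition rdvd (d x : R) : Prop := exists c, x = c * d.

(* R is a discrete valuation ring with uniformizer pi. *)
Definition is_dvr : Prop :=
  [/\ pi != 0, pi \isn't a GRing.unit
    & forall x, x != 0 -> exists u n, u \is a GRing.unit /\ x = u * pi ^+ n].

(* Every pi-adic Cauchy sequence converges.  Uniqueness of limits needs no
   axiom: in a discrete valuation ring the powers of (pi) intersect in 0. *)
Definition is_complete : Prop :=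
  forall s : nat -> R,
    (forall n, exists N, forall i j, (N <= i)%N -> (N <= j)%N ->
       rdvd (pi ^+ n) (s i - s j)) ->
    exists l, forall n, exists N, forall i, (N <= i)%N ->
       rdvd (pi ^+ n) (s i - l).

(* k is the residue field of R, with red the reduction map. *)
Definition is_residue_map (k : fieldType) (red : R -> k) : Prop :=
  (forall z, exists x, red x = z) /\ (forall x, red x = 0 <-> rdvd pi x).

(* f is the embedding of R in an algebraic closure L of its fraction field; v
   extends to L the valuation that sends pi to 1.  The value of v at 0, which
   should be infinite, is left unspecified. *)
Definition is_valuation_extension (L : fieldType) (f : R -> L) (v : L -> rat)
    : Prop :=
  [/\ forall x y, x != 0 -> y != 0 -> v (x * y) = v x + v y,
      forall x y, x != 0 -> y != 0 -> x + y != 0 ->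
        Num.min (v x) (v y) <= v (x + y)
    & forall u n, u \is a GRing.unit -> v (f (u * pi ^+ n)) = n%:R].

End DiscreteValuationRings.

Definition is_perfect (p : nat) (k : fieldType) : Prop :=
  forall x : k, exists y, y ^+ p = x.

Definition is_algebraic_closure (K : fieldType) (L : closedFieldType)
    (iota : K -> L) : Prop :=
  forall z, algebraicOver iota z.

(* Points of a plane Weierstrass curve: None is the point [0 : 1 : 0] at
   infinity, Some (x, y) the affine point (x, y). *)
Definition point (L : fieldType) : choiceType := option (L * L)%type.

(* The junk value at infinity is 0. *)
Definition xcoord (L : fieldType) (P : point L) : L :=
  if P is Some (x, _) then x else 0.

Definition map_point (L M : fieldType) (f : L -> M) (P : point L) : point M :=
  if P is Some (x, y) then Some (f x, f y) else None.

Definition proj_coords (L : fieldType) (P : point L) (i : 'I_3) : L :=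
  if P is Some (x, y) then [:: x; y; 1]`_i else [:: 0; 1; 0]`_i.

Section Curve.
(* The curve y^2 = x (x - a) (x - b). *)
Variables (L : fieldType) (a b : L).

Definition on_curve (P : point L) : Prop :=
  if P is Some (x, y) then y ^+ 2 = x * (x - a) * (x - b) else True.

Definition ec_opp (P : point L) : point L :=
  if P is Some (x, y) then Some (x, - y) else None.

(* Chord-tangent law; l is the slope of the line through the two points. *)
Definition ec_add (P Q : point L) : point L :=
  match P, Q with
  | None, _ => Q
  | _, None => P
  | Some (x1, y1), Some (x2, y2) =>
      if (x1 == x2) && (y1 == - y2) then None else
      let l := if x1 == x2
               then (3 * x1 ^+ 2 - 2 * (a + b) * x1 + a * b) / (2 * y1)
               else (y2 - y1) / (x2 - x1) in
      let x3 := l ^+ 2 + a + b - x1 - x2 in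
      Some (x3, l * (x1 - x3) - y1)
  end.

Definition ec_mul (n : nat) (P : point L) : point L := iter n (ec_add P) None.

(* The points (0, 0), (a, 0), (b, 0), for i = 0, 1, 2. *)
Definition two_torsion (i : 'I_3) : point L := Some ([:: 0; a; b]`_i, 0).

(* Y^2 Z - X (X - a Z) (X - b Z) *)
Definition weierstrass_cubic : {mpoly L[3]} :=
  let X := 'X_(inord 0) in let Y := 'X_(inord 1) in let Z := 'X_(inord 2) in
  Y ^+ 2 * Z - X * (X - a *: Z) * (X - b *: Z).

(* Jacobian criterion at the L-points of the projective plane; L is meant to
   be algebraically closed. *)
Definition nonsingular : Prop :=
  forall w : 'I_3 -> L, (exists i, w i != 0) ->
    weierstrass_cubic.@[w] = 0 ->
    exists i, (weierstrass_cubic^`M(i)).@[w] != 0.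

(* G is a subgroup of order p of the p-torsion of the group of points. *)
Definition is_p_subgroup (p : nat) (G : {fset point L}) : Prop :=
  [/\ forall Q, Q \in G -> on_curve Q /\ ec_mul p Q = None,
      None \in G,
      forall P Q, P \in G -> Q \in G -> ec_add P Q \in G,
      forall Q, Q \in G -> ec_opp Q \in G
    & #|` G| = p].

Definition is_half (G S : {fset point L}) : Prop :=
  let oppS := [fset ec_opp Q | Q in S]%fset in
  [/\ (S `<=` G)%fset, (S `&` oppS)%fset = fset0
    & G = (S `|` oppS `|` [fset None])%fset].

Definition hpoly (S : {fset point L}) : {poly L} :=
  \prod_(Q <- S) (1 - (xcoord Q)^-1 *: 'X).

Definition gpoly (S : {fset point L}) (i : 'I_3) : {poly L} :=
  \prod_(Q <- S) ('X - (xcoord (ec_add Q (two_torsion i)))%:P).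

End Curve.

Definition galois_stable (K L : fieldType) (iota : K -> L)
    (G : {fset point L}) : Prop :=
  forall s : {rmorphism L -> L}, bijective s ->
    (forall c, s (iota c) = iota c) ->
    [fset map_point s Q | Q in G]%fset = G.

Definition in_kernel_of_reduction (L : fieldType) (v : L -> rat)
    (P : point L) : Prop :=
  if P is Some (x, _) then x != 0 /\ v x < 0 else True.

Section Morphisms.
(* Points are taken in the field L; polynomials have coefficients in the
   subring A of definition, mapped to L by f. *)
Variables (A : comNzRingType) (L : fieldType) (f : A -> L).

Definition eval_at (T : 'I_3 -> {mpoly A[3]}) (P : point L) (i : 'I_3) : L :=
  (map_mpoly f (T i)).@[proj_coords P].

Definition defined_at (T : 'I_3 -> {mpoly A[3]}) (P : point L) : Prop :=
  exists i, eval_at T P i != 0.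

(* phi P = [T_0(P) : T_1(P) : T_2(P)] wherever the right-hand side makes
   sense. *)
Definition represents (a b : L) (phi : point L -> point L)
    (T : 'I_3 -> {mpoly A[3]}) : Prop :=
  forall P, on_curve a b P -> defined_at T P ->
    exists2 c, c != 0 & forall i, eval_at T P i = c * proj_coords (phi P) i.

Definition homogeneous_triple (T : 'I_3 -> {mpoly A[3]}) : Prop :=
  exists d, forall i, T i \is d.-homog.

(* Regular map, defined over A, from y^2 = x (x - a) (x - b) to
   y^2 = x (x - a') (x - b'), given by its effect on L-points. *)
Definition is_morphism (a b a' b' : L) (phi : point L -> point L) : Prop :=
  (forall P, on_curve a b P -> on_curve a' b' (phi P)) /\
  (forall P, on_curve a b P ->
     exists T, [/\ homogeneous_triple T, defined_at T P
                 & represents a b phi T]).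

(* A nonconstant morphism preserving the zero points; such a morphism is
   automatically a group homomorphism. *)
Definition is_isogeny (a b a' b' : L) (phi : point L -> point L) : Prop :=
  [/\ is_morphism a b a' b' phi, phi None = None
    & exists2 P, on_curve a b P & phi P <> None].

End Morphisms.

(* The relative Frobenius (x, y) |-> (x^p, y^p). *)
Definition frobenius (p : nat) (L : fieldType) : point L -> point L :=
  map_point (fun x => x ^+ p).

(* phi, a morphism of the generic fibres, extends to a morphism between the
   projective Weierstrass models over R, and the special fibre of the extension
   is phibar.  The local representatives have coefficients in R; those defined
   around the points of the special fibre cover the whole model, which is
   proper over the local ring R.  Here f : R -> L and fk : R -> M are the maps
   to algebraic closures of the fraction field and of the residue field. *)
Definition lifts (R : comNzRingType) (L M : fieldType) (f : R -> L)
    (fk : R -> M) (a b : R) (phi : point L -> point L)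
    (phibar : point M -> point M) : Prop :=
  forall P : point M, on_curve (fk a) (fk b) P ->
    exists T : 'I_3 -> {mpoly R[3]},
      [/\ homogeneous_triple T, defined_at fk T P,
          represents f (f a) (f b) phi T
        & represents fk (fk a) (fk b) phibar T].

(* KE is the function field over K of the curve y^2 = x (x - a) (x - b), with x
   and y the coordinate functions. *)
Definition is_function_field (K KE : fieldType) (a b : K) (j : K -> KE)
    (x y : KE) : Prop :=
  [/\ y ^+ 2 = x * (x - j a) * (x - j b),
      forall q : {poly K}, root (map_poly j q) x -> q = 0
    & forall z : KE, exists q r s : {poly K},
        s != 0 /\
        z = ((map_poly j q).[x] + (map_poly j r).[x] * y) / (map_poly j s).[x]].

Definition is_derivation (K KE : fieldType) (j : K -> KE) (M : lmodType KE)
    (D : KE -> M) : Prop :=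
  [/\ forall u w, D (u + w) = D u + D w,
      forall u w, D (u * w) = u *: D w + w *: D u
    & forall c, D (j c) = 0].

(* (Omega, d) is the module of Kaehler differentials of KE over K. *)
Definition is_kaehler (K KE : fieldType) (j : K -> KE) (Omega : lmodType KE)
    (d : KE -> Omega) : Prop :=
  is_derivation j d /\
  forall (M : lmodType KE) (D : KE -> M), is_derivation j D ->
    exists f : {linear Omega -> M},
      (forall z, D z = f (d z)) /\
      (forall f' : {linear Omega -> M}, (forall z, D z = f' (d z)) -> f' =1 f).

(* The pullback F^*(dx/y) = (F^* y)^-1 d(F^* x), for a map F with coordinate
   functions Fx = F^* x and Fy = F^* y. *)
Definition pullback_dx_over_y (KE : fieldType) (Omega : lmodType KE)
    (d : KE -> Omega) (Fx Fy : KE) : Omega :=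
  Fy^-1 *: d Fx.

(* The coordinates, at (x, y), of the map
   (x, y) |-> (x g_1(x)^2 / h(x)^2, g_1(x) g_2(x) g_3(x) y / h(x)^3). *)
Definition Fx_at (K L : fieldType) (j : K -> L) (h : {poly K})
    (g : 'I_3 -> {poly K}) (x : L) : L :=
  x * (map_poly j (g ord0)).[x] ^+ 2 / (map_poly j h).[x] ^+ 2.

Definition Fy_at (K L : fieldType) (j : K -> L) (h : {poly K})
    (g : 'I_3 -> {poly K}) (x y : L) : L :=
  (\prod_i (map_poly j (g i)).[x]) / (map_poly j h).[x] ^+ 3 * y.

(* Main.v *)
Require Import Defs.
From HB Require Import structures.
From mathcomp Require Import all_boot all_order all_algebra.
From mathcomp Require Import finmap.
From mathcomp.multinomials Require Import mpoly.
From mathcomp Require Import generic_quotient ring zify.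
From mathcomp Require boolp classical_sets.

Set Implicit Arguments.
Unset Strict Implicit.
Unset Printing Implicit Defensive.

Import Order.TTheory GRing.Theory Num.Theory.

Local Open Scope ring_scope.

(* Write n = (p - 1)/2, f(x) = x (x - a) (x - b), and let e run over 0, a, b.
   Multiplying over Q and -Q gives, for a generic point P,
     prod_{Q in G} (x(Q + P) - e) = h(e)^2 (x - e) g_e(x)^2 / h(x)^2,
   so the right-hand side is invariant under P |-> Q + P.  Hence the rational
   function (x g_1^2 - a' h^2 - (x - a) g_2^2) / h^2 of x, with
   a' = a g_1(a)^2 / h(a)^2, is invariant and of degree at most 2n; it takes
   its value at P at the p = 2n + 1 numbers x(Q + P), so it is constant, and it
   vanishes at x = a.  This is the identity that puts F on the curve E^(p), and
   comparing the derivatives of the three expressions for x o F, x o F - a' and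
   x o F - b' gives the pullback of dx/y.

   Galois descent puts h and g_i in K[x].  As x(Q) has negative valuation,
   x(Q + P_i) is congruent to x(P_i), so that h = 1 and g_i = (x - x(P_i))^n
   modulo the maximal ideal.  Finally X^3 is divisible by Z on the curve, which
   turns F into a triple of forms of degree p over R that has no base point on
   either fibre. *)

(** * Chords and tangents *)

(** Associativity of the chord-tangent law is proved only for x-coordinates and only with one point
    outside G, which is all that the invariance of the products asks for. The degree argument needs
    one P with p distinct values x(Q + P); it is found near infinity, where x(Q + P) tends to x(Q).
    Only Q and -Q share a limit, and y <> 0 separates them. The form of a^(p) comes from x(Q + P_1)
    = ab/x(Q), which gives g_1(a) = a^n h(b) and g_1(b) = b^n h(a). The three divisibilities behind
    the differential combine because the g_i are coprime: their roots reduce to the distinct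
    residues of 0, a, b. Nonsingularity of E^(p) is also read off on the special fibre, where a^(p)
    and b^(p) become the p-th powers of the residues of a and b. Galois stability speaks of
    automorphisms of the whole closure, so the descent first has to extend morphisms from K(z) to
    the closure. *)

Section ChordTangent.
Variables (L : fieldType) (a b : L).
Hypothesis two_neq0 : (2 : L) != 0.

(* Compares coefficients in
   x (x - a) (x - b) - (l x + c)^2 = (x - x1) (x - x2) (x - x3). *)
Definition chord (l c x1 x2 x3 : L) : Prop :=
  [/\ l ^+ 2 = x1 + x2 + x3 - a - b,
      2 * l * c = a * b - (x1 * x2 + x1 * x3 + x2 * x3)
    & c ^+ 2 = x1 * x2 * x3].

Lemma chordN l c x1 x2 x3 : chord l c x1 x2 x3 -> chord (- l) (- c) x1 x2 x3.
Proof. by case=> h1 h2 h3; split; rewrite -?h1 -?h2 -?h3; ring. Qed.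

Lemma chord_swap l c x1 x2 x3 : chord l c x1 x2 x3 -> chord l c x2 x1 x3.
Proof. by case=> h1 h2 h3; split; rewrite ?h1 ?h2 ?h3; ring. Qed.

Lemma chord_rot l c x1 x2 x3 : chord l c x1 x2 x3 -> chord l c x2 x3 x1.
Proof. by case=> h1 h2 h3; split; rewrite ?h1 ?h2 ?h3; ring. Qed.

Lemma chord_on_curve l c x1 x2 x3 :
  chord l c x1 x2 x3 -> on_curve a b (Some (x1, l * x1 + c)).
Proof.
case=> h1 h2 h3 /=.
have -> : (l * x1 + c) ^+ 2 = l ^+ 2 * x1 ^+ 2 + 2 * l * c * x1 + c ^+ 2 by ring.
by rewrite h1 h2 h3; ring.
Qed.

Lemma ec_opp_on_curve P : on_curve a b P -> on_curve a b (ec_opp P).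
Proof. by case: P => [[x y]|//] /=; rewrite sqrrN. Qed.

Lemma ec_oppK : involutive (@ec_opp L).
Proof. by case=> [[x y]|//] /=; rewrite opprK. Qed.

Lemma on_curve_eqx x y1 y2 :
  on_curve a b (Some (x, y1)) -> on_curve a b (Some (x, y2)) ->
  y1 = y2 \/ y1 = - y2.
Proof. by move=> /= h1 h2; apply/pred2P; rewrite -eqf_sqr h1 h2. Qed.

(** Trades the two slope formulas for the relation [chord], which is symmetric in the three points,
    so that any of them may be taken as the third one. *)
Lemma ec_add_exists_chord x1 y1 x2 y2 :
  on_curve a b (Some (x1, y1)) -> on_curve a b (Some (x2, y2)) ->
  ~~ ((x1 == x2) && (y1 == - y2)) ->
  exists l c x3,
    [/\ chord l c x1 x2 x3, y1 = l * x1 + c, y2 = l * x2 + c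
      & ec_add a b (Some (x1, y1)) (Some (x2, y2)) = Some (x3, - (l * x3 + c))].
Proof.
move=> c1 c2 nopp; rewrite /= (negbTE nopp).
set l := if _ then _ else _; pose c := y1 - l * x1.
pose x3 := l ^+ 2 + a + b - x1 - x2; rewrite -/x3.
have e1 : y1 = l * x1 + c by rewrite /c; ring.
have hl : l ^+ 2 = x1 + x2 + x3 - a - b by rewrite /x3; ring.
suff [e2 h2] : y2 = l * x2 + c /\
    2 * l * c = a * b - (x1 * x2 + x1 * x3 + x2 * x3).
  exists l, c, x3; split=> //; last by congr (Some (_, _)); rewrite /c; ring.
  split=> //.
  have -> : c ^+ 2 = y1 ^+ 2 - l ^+ 2 * x1 ^+ 2 - 2 * l * c * x1 by rewrite e1; ring.
  by rewrite c1 hl h2; ring.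
move: c1 c2 => /= c1 c2.
have [ex|nx] := eqVneq x1 x2.
  have ey : y1 = y2.
    have c2' : on_curve a b (Some (x1, y2)) by rewrite /= ex.
    have [//|ey] := @on_curve_eqx x1 y1 y2 c1 c2'.
    by rewrite ex ey !eqxx in nopp.
  have y0 : y1 != 0.
    by apply: contra nopp => /eqP y0; rewrite ex -ey y0 oppr0 !eqxx.
  rewrite -ey -ex; split=> //.
  have hly : 2 * l * y1 = 3 * x1 ^+ 2 - 2 * (a + b) * x1 + a * b.
    by rewrite /l -ex eqxx; field; rewrite ?y0 ?two_neq0.
  have -> : 2 * l * c = 2 * l * y1 - 2 * l ^+ 2 * x1 by rewrite e1; ring.
  by rewrite hly hl -ex; ring.
have dx : x1 - x2 != 0 by rewrite subr_eq0.
have dx' : x2 - x1 != 0 by rewrite subr_eq0 eq_sym.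
have e2 : y2 = l * x2 + c.
  by rewrite /c /l (negbTE nx); field.
(* The difference of the two curve equations is divisible by x1 - x2, and the quotient is the middle
   coefficient. *)
split=> //; apply: (mulfI dx).
have -> : (x1 - x2) * (2 * l * c) = y1 ^+ 2 - y2 ^+ 2 - l ^+ 2 * (x1 ^+ 2 - x2 ^+ 2).
  by rewrite e1 e2; ring.
by rewrite c1 c2 hl; ring.
Qed.

(** The relation determines the slope. When x1 = x2 it is a double root, so the line is the tangent
    there and 2 l y = f'(x1); the side condition excludes y = 0, where the tangent is vertical. *)
Lemma ec_add_chord l c x1 x2 x3 :
  chord l c x1 x2 x3 -> x1 != x2 \/ l * x1 + c != 0 ->
  ec_add a b (Some (x1, l * x1 + c)) (Some (x2, l * x2 + c)) =
  Some (x3, - (l * x3 + c)).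
Proof.
move=> hc nd /=.
have [h1 h2 h3] := hc.
have -> : (x1 == x2) && (l * x1 + c == - (l * x2 + c)) = false.
  have [ex|//] := eqVneq x1 x2; case: nd => [|nd]; first by rewrite ex eqxx.
  rewrite -ex -addr_eq0 /=; apply/negbTE.
  by rewrite -mulr2n -mulr_natl mulf_neq0.
set m := if _ then _ else _.
suff -> : m = l.
  have -> : l ^+ 2 + a + b - x1 - x2 = x3 by rewrite h1; ring.
  by congr (Some (_, _)); ring.
rewrite /m; have [ex|nx] := eqVneq x1 x2.
  case: nd => [|nd]; first by rewrite ex eqxx.
  apply: (mulIf (_ : 2 * (l * x1 + c) != 0)); first by rewrite mulf_neq0.
  rewrite divfK ?mulf_neq0 //.
  have -> : l * (2 * (l * x1 + c)) = 2 * l ^+ 2 * x1 + 2 * l * c by ring.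
  by rewrite h1 h2 -ex; ring.
have dx : x2 - x1 != 0 by rewrite subr_eq0 eq_sym.
by field.
Qed.

Lemma ec_add0P P : ec_add a b None P = P. Proof. by case: P. Qed.
Lemma ec_addP0 P : ec_add a b P None = P. Proof. by case: P => [[]|]. Qed.

Lemma ec_addNP P : ec_add a b (ec_opp P) P = None.
Proof. by case: P => [[x y]|] //=; rewrite !eqxx. Qed.

Lemma ec_add_on_curve P Q :
  on_curve a b P -> on_curve a b Q -> on_curve a b (ec_add a b P Q).
Proof.
case: P Q => [[x1 y1]|] [[x2 y2]|] // hP hQ.
case opp: ((x1 == x2) && (y1 == - y2)); first by rewrite /= opp.
have [l [c [x3 [hc _ _ ->]]]] := ec_add_exists_chord hP hQ (negbT opp).
exact: (@ec_opp_on_curve (Some (x3, _)) (chord_on_curve (chord_rot (chord_rot hc)))).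
Qed.

Lemma ec_addC P Q :
  on_curve a b P -> on_curve a b Q -> ec_add a b P Q = ec_add a b Q P.
Proof.
case: P Q => [[x1 y1]|] [[x2 y2]|] // hP hQ.
case opp: ((x1 == x2) && (y1 == - y2)).
  have opp' : (x2 == x1) && (y2 == - y1).
    by case/andP: opp => /eqP-> /eqP->; rewrite opprK !eqxx.
  by rewrite /= opp opp'.
have [l [c [x3 [hc e1 e2 ->]]]] := ec_add_exists_chord hP hQ (negbT opp).
rewrite e1 e2; apply/esym/ec_add_chord; first exact: chord_swap.
have [ex|nx] := eqVneq x2 x1; [right|by left].
apply/eqP => y0; rewrite e1 e2 -ex eqxx y0 oppr0 eqxx in opp.
by [].
Qed.

(** The line through Q and P, reflected in the x-axis, passes through -Q, Q + P and -P. The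
    condition on y serves the case where Q + P has the x-coordinate of Q and this line is a
    tangent. *)
Lemma ec_addKN Q P :
  on_curve a b Q -> on_curve a b P -> (if Q is Some (_, y) then y != 0 else true) ->
  ec_add a b (ec_opp Q) (ec_add a b Q P) = P.
Proof.
case: Q P => [[x1 y1]|] [[x2 y2]|] hQ hP y0 //; last by rewrite ec_addP0 ec_addNP.
case opp: ((x1 == x2) && (y1 == - y2)).
  have -> : ec_add a b (Some (x1, y1)) (Some (x2, y2)) = None by rewrite /= opp.
  rewrite ec_addP0 /=.
  by case/andP: opp => /eqP -> /eqP ->; rewrite opprK.
have [l [c [x3 [hc e1 e2 ->]]]] := ec_add_exists_chord hQ hP (negbT opp).
have Ne x : - (l * x + c) = - l * x - c by ring.
have -> : ec_opp (Some (x1, y1)) = Some (x1, - l * x1 - c) by rewrite /= e1 Ne.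
rewrite Ne.
have hc' := chordN (chord_swap (chord_rot (chord_rot hc))).
rewrite (ec_add_chord hc'); first by rewrite e2 mulNr -opprD opprK.
by right; rewrite -Ne -e1 oppr_eq0.
Qed.

(** P1 plays the generic point and P2, P3 are points of G, whence the asymmetric hypotheses: P1 is
    kept away from P2 and P3, but P2 = P3 is allowed and makes m the slope of a tangent. *)
Lemma xcoord_ec_addA x1 y1 x2 y2 x3 y3 x12 y12 x23 y23 :
  on_curve a b (Some (x1, y1)) -> on_curve a b (Some (x2, y2)) ->
  on_curve a b (Some (x3, y3)) ->
  x1 != x2 -> x1 != x3 ->
  ec_add a b (Some (x2, y2)) (Some (x1, y1)) = Some (x12, y12) ->
  ec_add a b (Some (x3, y3)) (Some (x2, y2)) = Some (x23, y23) ->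
  x12 != x3 -> x23 != x1 ->
  xcoord (ec_add a b (Some (x3, y3)) (Some (x12, y12))) =
  xcoord (ec_add a b (Some (x23, y23)) (Some (x1, y1))).
Proof.
move=> o1 o2 o3 n12 n13 e12 e23 n123 n231.
have nopp1 : ~~ ((x2 == x1) && (y2 == - y1)) by rewrite eq_sym (negbTE n12).
have nopp3 : ~~ ((x3 == x2) && (y3 == - y2)).
  by apply/negP => h; move: e23; rewrite /= h.
have [l [c [x12' [hc f2 f1 f12]]]] := ec_add_exists_chord o2 o1 nopp1.
have [m [d [x23' [hd g3 g2 g23]]]] := ec_add_exists_chord o3 o2 nopp3.
move: e12 e23; rewrite f12 g23 => -[? ey12] [? ey23]; subst x12' x23'.
have [hc1 hc2 hc3] := hc; have [hd1 hd2 hd3] := hd.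
rewrite /= (negbTE n231) eq_sym (negbTE n123) /=.
set mu := (y12 - y3) / (x12 - x3); set mu' := (y1 - y23) / (x1 - x23).
have d123 : x12 - x3 != 0 by rewrite subr_eq0.
have d231 : x1 - x23 != 0 by rewrite subr_eq0 eq_sym.
have d13 : x1 - x3 != 0 by rewrite subr_eq0.
have d12 : x2 - x1 != 0 by rewrite subr_eq0 eq_sym.
(* The third point of the line of slope mu through P1 + P2 and P3 is determined
   by l + mu, which E1 expresses through the slopes l of P1 P2 and m of P2 P3. *)
have E1 : (l + mu) * (l - m) = x1 - x3.
  have [ex|nx] := eqVneq x3 x2.
    have ey : y3 = y2 by rewrite g3 g2 ex.
    apply: (mulIf d123).
    rewrite /mu -ey12 [RHS]mulrC.
    have -> : (l + (- (l * x12 + c) - y3) / (x12 - x3)) * (l - m) * (x12 - x3)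
        = - (l * x3 + c + y3) * (l - m) by field.
    rewrite ey ex -f2.
    have -> : - (y2 + y2) * (l - m)
        = 2 * (m * x2 + d) * m - 2 * (l * x2 + c) * l by rewrite -f2 -g2; ring.
    have -> : 2 * (m * x2 + d) * m - 2 * (l * x2 + c) * l =
       2 * m ^+ 2 * x2 + 2 * m * d - (2 * l ^+ 2 * x2 + 2 * l * c) by ring.
    by rewrite hd1 hd2 hc1 hc2 ex; ring.
  have dx : x2 - x3 != 0 by rewrite subr_eq0 eq_sym.
  have hm : m = (y2 - y3) / (x2 - x3) by rewrite g2 g3; field.
  apply: (mulIf d123); apply: (mulIf dx).
  rewrite /mu -ey12 hm.
  have -> : (l + (- (l * x12 + c) - y3) / (x12 - x3)) * (l - (y2 - y3) / (x2 - x3))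
     * (x12 - x3) * (x2 - x3) = - (l * x3 + c + y3) * (y3 - (l * x3 + c)).
    by rewrite f2; field; rewrite d123 dx.
  have -> : - (l * x3 + c + y3) * (y3 - (l * x3 + c)) =
     l ^+ 2 * x3 ^+ 2 + 2 * l * c * x3 + c ^+ 2 - y3 ^+ 2 by ring.
  by rewrite o3 hc1 hc2 hc3; ring.
have E2 : (m + mu') * (m - l) = x3 - x1.
  apply: (mulIf d231); apply: (mulIf d12).
  have hl : l = (y2 - y1) / (x2 - x1) by rewrite f2 f1; field.
  rewrite /mu' -ey23 hl.
  have -> : (m + (y1 - - (m * x23 + d)) / (x1 - x23)) * (m - (y2 - y1) / (x2 - x1))
     * (x1 - x23) * (x2 - x1) = - (y1 + (m * x1 + d)) * (y2 - y1 - m * (x2 - x1)).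
    by field; rewrite d231 d12.
  have -> : - (y1 + (m * x1 + d)) * (y2 - y1 - m * (x2 - x1)) =
     y1 ^+ 2 - (m ^+ 2 * x1 ^+ 2 + 2 * m * d * x1 + d ^+ 2) by rewrite g2; ring.
  by rewrite o1 hd1 hd2 hd3; ring.
have hml : l - m != 0 by apply/eqP => h; rewrite h mulr0 in E1; rewrite -E1 eqxx in d13.
(* E1 and E2 are mirror images, and l - m is nonzero because x1 - x3 is. The two x-coordinates then
   differ by a multiple of E1. *)
have E3 : l + mu = m + mu'.
  apply: (mulIf hml); rewrite E1.
  by rewrite -(opprB m l) mulrN E2; ring.
have hmu : mu' = l + mu - m by rewrite E3; ring.
have x12E : x12 = l ^+ 2 + a + b - x1 - x2 by rewrite hc1; ring.
have x23E : x23 = m ^+ 2 + a + b - x2 - x3 by rewrite hd1; ring.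
rewrite x12E x23E hmu; apply/eqP; rewrite -subr_eq0; apply/eqP.
transitivity (2 * ((x1 - x3) - (l + mu) * (l - m))); first by ring.
by rewrite E1; ring.
Qed.

End ChordTangent.

(** * Translation by a point of order two, and by Q and -Q together *)

Section TranslationFormulas.
Variables (L : fieldType) (a b : L).

Definition fprime (e : L) : L := 3 * e ^+ 2 - 2 * (a + b) * e + a * b.

(* x(Q + (e, 0)) for q = x(Q); fprime is f', for f = x (x - a) (x - b). *)
Definition xtrans (e q : L) : L := e + fprime e / (q - e).

Definition xpoly (xs : seq L) : {poly L} := \prod_(q <- xs) (1 - q^-1 *: 'X).

Definition tpoly (e : L) (xs : seq L) : {poly L} :=
  \prod_(q <- xs) ('X - (xtrans e q)%:P).

Lemma xcoord_add_two_torsion e q r :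
  e \in [:: 0; a; b] -> q != e -> on_curve a b (Some (q, r)) ->
  xcoord (ec_add a b (Some (q, r)) (Some (e, 0))) = xtrans e q.
Proof.
move=> he nq /= hq; rewrite (negbTE nq) /=.
have d : q - e != 0 by rewrite subr_eq0.
have d' : e - q != 0 by rewrite subr_eq0 eq_sym.
have -> : ((0 - r) / (e - q)) ^+ 2 = r ^+ 2 / (q - e) ^+ 2.
  by field; rewrite d d'.
rewrite hq /xtrans /fprime.
by move: he d; rewrite !inE => /or3P[] /eqP ->; rewrite ?subr0 => d; field; rewrite ?d.
Qed.

(** The factors are exchanged by r -> -r, so their product involves only r^2 and y^2. As a function
    of P it has double zeros at (e, 0) + Q and (e, 0) - Q and double poles at Q and -Q, which
    explains the square. *)
Lemma xcoord_add_mul_sub e q r x y :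
  e \in [:: 0; a; b] -> q != 0 -> q != e -> q != x ->
  on_curve a b (Some (q, r)) -> on_curve a b (Some (x, y)) ->
  (xcoord (ec_add a b (Some (q, r)) (Some (x, y))) - e) *
  (xcoord (ec_add a b (ec_opp (Some (q, r))) (Some (x, y))) - e) =
  ((1 - q^-1 * e) * (x - xtrans e q) / (1 - q^-1 * x)) ^+ 2.
Proof.
move=> he q0 nq nx /= hq hx; rewrite (negbTE nx) /= opprK.
have d : x - q != 0 by rewrite subr_eq0 eq_sym.
set t := _ + _ - q - x.
have Et z : z ^+ 2 + a + b - q - x - e = z ^+ 2 + (a + b - q - x - e) by ring.
rewrite !Et.
have -> : (((y - r) / (x - q)) ^+ 2 + (a + b - q - x - e)) *
          (((y + r) / (x - q)) ^+ 2 + (a + b - q - x - e)) =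
  ((y ^+ 2 - r ^+ 2) ^+ 2 + 2 * (a + b - q - x - e) * (x - q) ^+ 2 * (y ^+ 2 + r ^+ 2))
   / (x - q) ^+ 4 + (a + b - q - x - e) ^+ 2 by field.
rewrite hq hx /xtrans /fprime.
have d1 : q - e != 0 by rewrite subr_eq0.
have d2 : q - x != 0 by rewrite subr_eq0.
by move: he d1; rewrite !inE => /or3P[] /eqP ->; rewrite ?subr0 => d1;
  field; rewrite ?d ?q0 ?d1 ?d2.
Qed.

(** An entry 0 would contribute the factor 1, as 0^-1 = 0, and would not be a root. *)
Lemma root_xpoly xs x : 0 \notin xs -> root (xpoly xs) x = (x \in xs).
Proof.
elim: xs => [|q xs IH]; first by rewrite /xpoly big_nil rootC oner_eq0.
rewrite inE negb_or eq_sym => /andP[q0 /IH]; rewrite /xpoly big_cons rootM => ->.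
rewrite inE; congr orb; rewrite rootE !hornerE /= subr_eq0.
apply/eqP/eqP => [e|->]; last by rewrite mulVf.
by rewrite -[x](mulVKf q0) -e mulr1.
Qed.

End TranslationFormulas.

(** * Finding a point with distinct translates *)

Section CofinitelyMany.
Variable L : closedFieldType.

(* Here t = 1/x, so that t = 0 is the point at infinity; asking that r does not
   vanish there makes it enough to compare leading terms. *)
Definition almost_all (P : L -> Prop) : Prop :=
  exists2 r : {poly L}, r.[0] != 0 & forall t, t != 0 -> r.[t] != 0 -> P t.

Lemma almost_all_seq (I : eqType) (s : seq I) (P : I -> L -> Prop) :
  (forall i, i \in s -> almost_all (P i)) ->
  almost_all (fun t => forall i, i \in s -> P i t).
Proof.
elim: s => [|i s IH] h; first by exists 1; rewrite ?hornerE ?oner_neq0.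
have [r r0 hr] := h i (mem_head _ _).
have [j jin|q q0 hq] := IH; first by apply: h; rewrite inE jin orbT.
exists (r * q) => [|t t0]; first by rewrite hornerM mulf_neq0.
rewrite hornerM mulf_eq0 negb_or => /andP[rt qt] j.
by rewrite inE => /predU1P[->|js]; [apply: hr | apply: hq].
Qed.

Lemma almost_all_exists P : almost_all P -> exists2 t, t != 0 & P t.
Proof.
case=> r r0 hr.
have /closed_nonrootP[t] : 'X * r != 0.
  apply: mulf_neq0; first by rewrite polyX_eq0.
  by apply: contraNneq r0 => ->; rewrite horner0.
rewrite rootE hornerM hornerX mulf_eq0 negb_or => /andP[t0 rt].
by exists t => //; apply: hr.
Qed.

End CofinitelyMany.

Section DistinctTranslates.
Variables (L : closedFieldType) (a b : L).
Hypothesis two_neq0 : (2 : L) != 0.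

Local Notation x_add Q P := (xcoord (ec_add a b Q P)).

(** Cleared of denominators, equality reads A(t) = B(t) y t^2, where (y t^2)^2 = t (1 - a t) (1 - b
    t). Eliminating y gives the excluded polynomial; it is 1 at t = 0, where x(P) has a pole and x(Q
    + P) has none. *)
Lemma translate_neq_self q r :
  on_curve a b (Some (q, r)) ->
  almost_all (fun t => forall y, on_curve a b (Some (t^-1, y)) -> q != t^-1 ->
    x_add (Some (q, r)) (Some (t^-1, y)) != x_add None (Some (t^-1, y))).
Proof.
move=> /= hq.
pose A : {poly L} := (1 - a *: 'X) * (1 - b *: 'X) + (r ^+ 2) *: 'X ^+ 3
  + ((a + b - q) *: 'X - 2%:P) * (1 - q *: 'X) ^+ 2.
pose B : {poly L} := (2 * r) *: 'X.
exists (A ^+ 2 - B ^+ 2 * ('X * (1 - a *: 'X) * (1 - b *: 'X))).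
  have A0 : A.[0] = -1 by rewrite /A !(hornerE, horner_exp) /=; ring.
  have B0 : B.[0] = 0 by rewrite /B !(hornerE, horner_exp) /=; ring.
  rewrite hornerD hornerN !(horner_exp, hornerM) A0 B0 sqrrN !expr2.
  by rewrite !(mul0r, mul1r) subr0 oner_neq0.
move=> t t0 hr y hy nq; apply: contraNneq hr; rewrite /= (negbTE nq) /=.
have d : t^-1 - q != 0 by rewrite subr_eq0 eq_sym.
have d1 : 1 - q * t != 0.
  by apply: contraNneq d => h; rewrite -[_ - q](mulfK t0) mulrBl mulVf // h mul0r.
move=> /eqP; rewrite -subr_eq0 => /eqP E.
have {}E : (y - r) ^+ 2 + (a + b - q - 2 * t^-1) * (t^-1 - q) ^+ 2 = 0.
  have -> : (y - r) ^+ 2 = ((y - r) / (t^-1 - q)) ^+ 2 * (t^-1 - q) ^+ 2.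
    by rewrite expr_div_n divfK // expf_neq0.
  rewrite -mulrDl; apply/eqP; rewrite mulf_eq0; apply/orP; left; apply/eqP.
  by rewrite -[RHS]E; ring.
have hy2 : y ^+ 2 * t ^+ 3 = (1 - a * t) * (1 - b * t) by rewrite hy; field.
have eA : A.[t] = B.[t] * (y * t ^+ 2).
  have -> : A.[t] = y ^+ 2 * t ^+ 3 + r ^+ 2 * t ^+ 3
      + ((a + b - q) * t - 2) * (1 - q * t) ^+ 2.
    by rewrite hy2 /A !(hornerE, horner_exp) /=; ring.
  rewrite /B !hornerE /=.
  rewrite -[RHS]addr0 -[X in _ = _ + X](mul0r (t ^+ 3)) -[in RHS]E.
  by field.
rewrite hornerD hornerN !(horner_exp, hornerM) eA.
have -> : ('X : {poly L}).[t] * (1 - a *: 'X).[t] * (1 - b *: 'X).[t] =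
   t * (y ^+ 2 * t ^+ 3) by rewrite hy2 !hornerE /=; ring.
by apply/eqP; ring.
Qed.

(** Equality forces 4 r y = 0, hence y = 0, which happens only where (1 - a t) (1 - b t)
    vanishes. *)
Lemma translate_neq_opp q r :
  r != 0 ->
  almost_all (fun t => forall y, on_curve a b (Some (t^-1, y)) -> q != t^-1 ->
    x_add (Some (q, r)) (Some (t^-1, y)) != x_add (Some (q, - r)) (Some (t^-1, y))).
Proof.
move=> r0.
exists ((1 - a *: 'X) * (1 - b *: 'X)).
  by rewrite !hornerE /= !(mulr0, subr0) mulr1 oner_neq0.
move=> t t0 hr y hy nq; apply: contraNneq hr; rewrite /= (negbTE nq) /=.
have d : t^-1 - q != 0 by rewrite subr_eq0 eq_sym.
move=> E.
have {}E : ((y - r) / (t^-1 - q)) ^+ 2 = ((y - - r) / (t^-1 - q)) ^+ 2.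
  by apply: (addIr (a + b - q - t^-1)); rewrite !addrA.
have {}E : y = 0.
  have h4 : (2 * 2) * r != 0 by rewrite !mulf_neq0.
  apply: (mulIf h4); rewrite mul0r; move/eqP: E; rewrite -subr_eq0 !expr_div_n -mulrBl mulf_eq0.
  rewrite invr_eq0 expf_eq0 (negbTE d) /= orbF => /eqP E.
  by rewrite -oppr0 -E; ring.
have hy2 : y ^+ 2 * t ^+ 3 = (1 - a * t) * (1 - b * t) by rewrite hy; field.
by rewrite !hornerE /= -hy2 E expr0n mul0r.
Qed.

(** Same elimination of y as in [translate_neq_self]. The value at t = 0 is (q - q')^2, since the
    two sides tend to q and q' there. *)
Lemma translate_neq q r q' r' :
  q != q' ->
  almost_all (fun t => forall y, on_curve a b (Some (t^-1, y)) ->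
    q != t^-1 -> q' != t^-1 ->
    x_add (Some (q, r)) (Some (t^-1, y)) != x_add (Some (q', r')) (Some (t^-1, y))).
Proof.
move=> nqq.
pose f : {poly L} := (1 - a *: 'X) * (1 - b *: 'X).
pose u : {poly L} := 1 - q *: 'X.
pose u' : {poly L} := 1 - q' *: 'X.
pose A := (q - q') *: f * (2%:P - (q + q') *: 'X)
  + 'X ^+ 2 * (r ^+ 2 *: u' ^+ 2 - r' ^+ 2 *: u ^+ 2)
  - (q - q') *: (u ^+ 2 * u' ^+ 2).
pose B := 2 *: (r *: u' ^+ 2 - r' *: u ^+ 2).
have dqq : q - q' != 0 by rewrite subr_eq0.
exists (A ^+ 2 - B ^+ 2 * 'X * f).
  have A0 : A.[0] = q - q'.
    by rewrite /A /f /u /u' !(hornerE, horner_exp) /=; ring.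
  by rewrite hornerD hornerN !(horner_exp, hornerM) A0 hornerX !(mulr0, mul0r) subr0 expf_neq0.
move=> t t0 hr y hy nq nq'; apply: contraNneq hr; rewrite /= (negbTE nq) (negbTE nq') /=.
have d : t^-1 - q != 0 by rewrite subr_eq0 eq_sym.
have d' : t^-1 - q' != 0 by rewrite subr_eq0 eq_sym.
move=> E.
have {}E : (y - r) ^+ 2 * (t^-1 - q') ^+ 2 - (y - r') ^+ 2 * (t^-1 - q) ^+ 2
     - (q - q') * (t^-1 - q) ^+ 2 * (t^-1 - q') ^+ 2 = 0.
  have -> : (y - r) ^+ 2 = ((y - r) / (t^-1 - q)) ^+ 2 * (t^-1 - q) ^+ 2.
    by rewrite expr_div_n divfK // expf_neq0.
  have -> : (y - r') ^+ 2 = ((y - r') / (t^-1 - q')) ^+ 2 * (t^-1 - q') ^+ 2.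
    by rewrite expr_div_n divfK // expf_neq0.
  move/eqP: E; rewrite -subr_eq0 => /eqP E.
  by rewrite -[RHS](mul0r ((t^-1 - q) ^+ 2 * (t^-1 - q') ^+ 2)) -[in RHS]E; ring.
have hy2 : y ^+ 2 * t ^+ 3 = f.[t] by rewrite hy /f !hornerE /=; field.
have eA : A.[t] = B.[t] * (y * t ^+ 2).
  have -> : A.[t] = (q - q') * (y ^+ 2 * t ^+ 3) * (2 - (q + q') * t)
      + t ^+ 2 * (r ^+ 2 * (1 - q' * t) ^+ 2 - r' ^+ 2 * (1 - q * t) ^+ 2)
      - (q - q') * ((1 - q * t) ^+ 2 * (1 - q' * t) ^+ 2).
    by rewrite hy2 /A /f /u /u' !(hornerE, horner_exp) /=; ring.
  rewrite /B /u /u' !(hornerE, horner_exp) /=.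
  rewrite -[RHS]addr0 -[X in _ = _ + X](mul0r (t ^+ 4)) -[in RHS]E.
  by field.
have -> : (A ^+ 2 - B ^+ 2 * 'X * f).[t] = A.[t] ^+ 2 - B.[t] ^+ 2 * t * f.[t].
  by rewrite hornerD hornerN [(_ * f).[t]]hornerM [(_ * 'X).[t]]hornerM hornerX !horner_exp.
by rewrite eA -hy2; apply/eqP; ring.
Qed.

End DistinctTranslates.

(** * Translation by the points of G *)

Section Subgroup.
Variables (L : closedFieldType) (a b : L) (p : nat) (G S : {fset point L}).
Hypothesis two_neq0 : (2 : L) != 0.
Hypothesis hG : is_p_subgroup a b p G.
Hypothesis hS : is_half G S.
Hypothesis x_notin_roots : forall x y, Some (x, y) \in G -> x \notin [:: 0; a; b].

Definition xcoords : seq L := [seq xcoord Q | Q <- enum_fset S].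
Local Notation add := (ec_add a b).
Local Notation x_add Q P := (xcoord (add Q P)).

Lemma subgroup_on_curve Q : Q \in G -> on_curve a b Q.
Proof. by case: hG => h _ _ _ _ /h[]. Qed.

Lemma subgroup_y_neq0 x y : Some (x, y) \in G -> y != 0.
Proof.
move=> QG; have := x_notin_roots QG; have /= := subgroup_on_curve QG.
move=> hy; apply: contra => /eqP y0; move/eqP: hy.
by rewrite y0 expr0n /= eq_sym !mulf_eq0 !subr_eq0 !inE -orbA.
Qed.

Lemma subgroup_addKN Q P :
  Q \in G -> on_curve a b P -> add (ec_opp Q) (add Q P) = P.
Proof.
move=> QG hP; apply: ec_addKN => //; first exact: subgroup_on_curve.
by case: Q QG => [[x y]|//]; apply: subgroup_y_neq0.
Qed.

Lemma half_mem Q : Q \in S -> exists x y,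
  [/\ Q = Some (x, y), Some (x, y) \in G & Some (x, - y) \notin S].
Proof.
case: hS => /fsubsetP sub /fsetP dis _ QS.
case: Q QS => [[x y]|] QS.
  exists x, y; split=> //; first exact: sub.
  apply/negP => oS; have := dis (Some (x, y)).
  rewrite !inE QS => /negbT/negP; apply.
  by apply/imfsetP; exists (Some (x, - y)) => //=; rewrite opprK.
have := dis None; rewrite !inE QS => /negbT/negP[].
by apply/imfsetP; exists None.
Qed.

Lemma half_perm :
  perm_eq G (None :: [seq Q | Q <- S] ++ [seq ec_opp Q | Q <- S]).
Proof.
rewrite map_id; case: (hS) => _ _ ->; apply: uniq_perm; first exact: fset_uniq.
  have injo : injective (@ec_opp L) := inv_inj (@ec_oppK L).
  rewrite cons_uniq cat_uniq (map_inj_uniq injo) fset_uniq /=.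
  rewrite mem_cat negb_or -andbA; apply/and3P; split.
  - by apply/negP => /half_mem[x [y []]].
  - by apply/mapP => -[Q /half_mem[x [y [-> _ _]]]].
  rewrite andbT; apply/hasPn => _ /mapP[Q QS ->].
  by have [x [y [-> _ h]]] := half_mem QS.
move=> Q; rewrite !inE mem_cat orbC; congr (_ || (_ || _)).
apply/imfsetP/mapP => -[P /= PS ->]; by exists P.
Qed.

Lemma subgroup_card : p = (size xcoords).*2.+1.
Proof.
case: hG => _ _ _ _ <-.
by rewrite (perm_size half_perm) /= size_cat !size_map addnn.
Qed.

Lemma mem_xcoords x y : Some (x, y) \in G -> x \in xcoords.
Proof.
rewrite (perm_mem half_perm) inE /= map_id mem_cat => /orP[QS|].
  by apply/mapP; exists (Some (x, y)).
by case/mapP => -[[x' y']|//] QS [-> _]; apply/mapP; exists (Some (x', y')).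
Qed.

Lemma xcoords_mem x y :
  x \in xcoords -> on_curve a b (Some (x, y)) -> Some (x, y) \in G.
Proof.
case/mapP => Q /half_mem[x' [y' [-> QG _]]] /= ->.
move=> /(on_curve_eqx (subgroup_on_curve QG))[<-//|ey].
have [_ _ _ hopp _] := hG; have := hopp _ QG.
by rewrite /= ey opprK.
Qed.

Lemma xcoords_exists x : x \in xcoords -> exists y, Some (x, y) \in G.
Proof. by case/mapP => Q /half_mem[x' [y [-> QG _]]] /= ->; exists y. Qed.

(** Two points of S with the same x-coordinate are equal or opposite, and S contains no opposite
    pair. *)
Lemma xcoords_uniq : uniq xcoords.
Proof.
rewrite map_inj_in_uniq ?fset_uniq // => Q Q' /half_mem[x [y [-> QG nS]]].
move=> Q'S; have [x' [y' [eQ' QG' _]]] := half_mem Q'S; rewrite eQ' /= => ex.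
move: QG' Q'S; rewrite eQ' -ex => QG' Q'S.
have [->//|ey] := on_curve_eqx (subgroup_on_curve QG) (subgroup_on_curve QG').
by rewrite ey opprK Q'S in nS.
Qed.

Lemma prod_subgroup (M : comNzRingType) (phi : point L -> M) :
  \prod_(Q <- G) phi Q = phi None * \prod_(Q <- S) (phi Q * phi (ec_opp Q)).
Proof.
by rewrite (perm_big _ half_perm) /= big_cons big_cat /= !big_map -big_split.
Qed.

Section Outside.
Variable P : point L.
Hypotheses (hP : on_curve a b P) (PG : P \notin G).

Lemma outside_xcoord : exists x y, P = Some (x, y) /\ x \notin xcoords.
Proof.
case: P hP PG => [[x y]|] hP' PG'.
  exists x, y; split=> //; apply: contra PG' => xin; exact: xcoords_mem xin hP'.
by case: hG PG' => _ ->.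
Qed.

Lemma outside_translate Q : Q \in G -> add Q P \notin G.
Proof.
move=> QG; apply: contra PG => h; rewrite -(subgroup_addKN QG hP).
by case: hG => _ _ hadd hopp _; apply: hadd => //; apply: hopp.
Qed.

(** An injective map of a finite set to itself permutes it. Cancellation is available on the left
    only, so the summands are first exchanged. *)
Lemma subgroup_translate_perm Q : Q \in G -> perm_eq [seq add R Q | R <- G] G.
Proof.
move=> QG; case: hG => _ _ hadd _ _.
have un : uniq [seq add R Q | R <- G].
  rewrite map_inj_in_uniq ?fset_uniq // => R R' RG RG'.
  have oR T : T \in G -> on_curve a b T by exact: subgroup_on_curve.
  rewrite !(@ec_addC _ _ _ two_neq0 _ Q); try exact: oR.
  move=> e; rewrite -(subgroup_addKN QG (oR _ RG)) e subgroup_addKN //; exact: oR.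
apply: uniq_perm => //.
apply: (uniq_min_size un _ _).2; last by rewrite size_map.
by move=> _ /mapP[R RG ->]; apply: hadd.
Qed.
End Outside.

(** The inequalities required by [xcoord_ec_addA] hold because P and Q0 + P stay outside G, hence
    have x-coordinates outside [xcoords]. The case Q = -Q0, where the inner sum is the zero point,
    is cancellation. *)
Lemma x_addA Q Q0 P : Q \in G -> Q0 \in G -> on_curve a b P -> P \notin G ->
  x_add Q (add Q0 P) = x_add (add Q Q0) P.
Proof.
move=> QG Q0G hP PG.
have [x1 [y1 [eP x1n]]] := outside_xcoord hP PG.
have RG := outside_translate hP PG Q0G.
have oR := ec_add_on_curve two_neq0 (subgroup_on_curve Q0G) hP.
have [x12 [y12 [eR x12n]]] := outside_xcoord oR RG.
case: Q QG => [[x3 y3]|] QG; last by rewrite !ec_add0P.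
case: Q0 Q0G RG oR eR => [[x2 y2]|] Q0G RG oR eR; last by rewrite ec_add0P ec_addP0.
have sG : add (Some (x3, y3)) (Some (x2, y2)) \in G by case: hG => _ _ h _ _; apply: h.
case eQ: (add (Some (x3, y3)) (Some (x2, y2))) sG => [[x23 y23]|] sG; last first.
  have [ex ey] : x3 = x2 /\ y3 = - y2.
    by move: eQ => /=; case: ifP => [/andP[/eqP-> /eqP->]|].
  by rewrite ex ey ec_add0P (subgroup_addKN Q0G hP).
rewrite eR eP; move: (mem_xcoords QG) (mem_xcoords Q0G) (mem_xcoords sG) => h3 h2 h23.
have oP : on_curve a b (Some (x1, y1)) by rewrite -eP.
have e12 : add (Some (x2, y2)) (Some (x1, y1)) = Some (x12, y12) by rewrite -eP.
apply: (xcoord_ec_addA two_neq0 oP (subgroup_on_curve Q0G) (subgroup_on_curve QG)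
  _ _ e12 eQ).
- by apply: contraNneq x1n => ->.
- by apply: contraNneq x1n => ->.
- by apply: contraNneq x12n => ->.
- by apply: contraNneq x1n => <-.
Qed.

Lemma prod_translates_invariant (M : comNzRingType) (phi : L -> M) Q0 P :
  Q0 \in G -> on_curve a b P -> P \notin G ->
  \prod_(Q <- G) phi (x_add Q (add Q0 P)) = \prod_(Q <- G) phi (x_add Q P).
Proof.
move=> Q0G hP PG.
rewrite -[RHS](perm_big _ (subgroup_translate_perm Q0G)) /= big_map.
by rewrite !big_seq; apply: eq_bigr => Q QG; rewrite x_addA.
Qed.

Local Notation h := (xpoly xcoords).
Local Notation g e := (tpoly a b e xcoords).

Lemma zero_notin_xcoords : 0 \notin xcoords.
Proof. by apply/negP => /xcoords_exists[y /x_notin_roots]; rewrite mem_head. Qed.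

Lemma horner_xpoly_neq0 x : x \notin xcoords -> h.[x] != 0.
Proof. by rewrite -(root_xpoly x zero_notin_xcoords). Qed.

Lemma prod_translates e x y : e \in [:: 0; a; b] ->
  on_curve a b (Some (x, y)) -> x \notin xcoords ->
  \prod_(Q <- G) (x_add Q (Some (x, y)) - e) =
  h.[e] ^+ 2 * ((x - e) * (g e).[x] ^+ 2 / h.[x] ^+ 2).
Proof.
move=> he hP xn.
rewrite (prod_subgroup (fun Q => x_add Q (Some (x, y)) - e)) ec_add0P /=.
have -> : \prod_(Q <- S) ((x_add Q (Some (x, y)) - e) *
           (x_add (ec_opp Q) (Some (x, y)) - e)) =
   \prod_(q <- xcoords) ((1 - q^-1 * e) * (x - xtrans a b e q) / (1 - q^-1 * x)) ^+ 2.
  rewrite big_map !big_seq; apply: eq_bigr => Q QS.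
  have [q [r [eQ QG _]]] := half_mem QS; rewrite eQ.
  have := x_notin_roots QG => nroots.
  rewrite xcoord_add_mul_sub //; first by apply: contraNneq nroots => ->; rewrite mem_head.
  - by apply: contraNneq nroots => ->.
  - by apply: contraNneq xn => <-; apply: mem_xcoords QG.
  exact: subgroup_on_curve.
rewrite prodrXl /xpoly /tpoly !horner_prod.
rewrite !big_split /= prodfV.
have hh z : \prod_(i <- xcoords) (1 - i^-1 * z) = \prod_(i <- xcoords) (1 - i^-1 *: 'X).[z].
  by apply: eq_bigr => i _; rewrite !hornerE.
rewrite !hh.
have -> : \prod_(i <- xcoords) (x - xtrans a b e i) =
   \prod_(i <- xcoords) ('X - (xtrans a b e i)%:P).[x].
  by apply: eq_bigr => i _; rewrite !hornerE.
by rewrite !exprMn exprVn; ring.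
Qed.

End Subgroup.

Lemma almost_all_and (L : closedFieldType) (P Q : L -> Prop) :
  almost_all P -> almost_all Q -> almost_all (fun t => P t /\ Q t).
Proof.
case=> r r0 hr [q q0 hq]; exists (r * q) => [|t t0].
  by rewrite hornerM mulf_neq0.
by rewrite hornerM mulf_eq0 negb_or => /andP[/(hr _ t0) ? /(hq _ t0) ?].
Qed.

Lemma size_tpoly (L : fieldType) (a b e : L) xs :
  size (tpoly a b e xs) = (size xs).+1.
Proof. exact: size_prod_XsubC. Qed.

Lemma monic_tpoly (L : fieldType) (a b e : L) xs : tpoly a b e xs \is monic.
Proof. exact: monic_prod_XsubC. Qed.

Lemma size_xpoly_leq (L : fieldType) (xs : seq L) :
  (size (xpoly xs) <= (size xs).+1)%N.
Proof.
elim: xs => [|q xs IH]; first by rewrite /xpoly big_nil size_poly1.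
rewrite /xpoly big_cons; apply: leq_trans (size_polyMleq _ _) _.
have : (size (1 - q^-1 *: 'X : {poly L})%R <= 2)%N.
  apply: leq_trans (size_polyD _ _) _; rewrite size_poly1 size_polyN geq_max /=.
  by apply: leq_trans (size_scale_leq _ _) _; rewrite size_polyX.
rewrite -/(xpoly xs) /= => h.
by rewrite -subn1 leq_subLR; apply: leq_add h IH.
Qed.

(** * The polynomial identities between h and the g_i *)

Section TranslateIdentity.
Variables (L : closedFieldType) (a b : L) (p : nat) (G S : {fset point L}).
Hypothesis two_neq0 : (2 : L) != 0.
Hypothesis hG : is_p_subgroup a b p G.
Hypothesis hS : is_half G S.
Hypothesis x_notin_roots : forall x y, Some (x, y) \in G -> x \notin [:: 0; a; b].

Local Notation xs := (xcoords S).
Local Notation add := (ec_add a b).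
Local Notation x_add Q P := (xcoord (add Q P)).
Local Notation h := (xpoly xs).
Local Notation g e := (tpoly a b e xs).

(** Distinct affine points of G have different x-coordinates or are opposite with y nonzero; [None]
    is the remaining case. *)
Lemma translates_distinct Q Q' : Q \in G -> Q' \in G -> Q != Q' ->
  almost_all (fun t => forall y, on_curve a b (Some (t^-1, y)) ->
    t^-1 \notin xs -> x_add Q (Some (t^-1, y)) != x_add Q' (Some (t^-1, y))).
Proof.
have mono (P P' : L -> Prop) : (forall t, P t -> P' t) -> almost_all P -> almost_all P'.
  by move=> h [r r0 hr]; exists r => // t t0 rt; apply/h/hr.
have neqx t q r : Some (q, r) \in G -> t \notin xs -> q != t.
  by move=> QG; apply: contraNneq => <-; apply: (mem_xcoords hS QG).
have oG T : T \in G -> on_curve a b T by apply: (subgroup_on_curve hG).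
case: Q Q' => [[q r]|] [[q' r']|] QG QG' // nQ.
- have [eq|nq] := eqVneq q q'; last first.
    apply: mono (@translate_neq L a b q r q' r' nq) => t ht y hy tn.
    by apply: ht => //; apply: neqx tn; eauto.
  have er : r' = - r.
    have QG2 := QG'; rewrite -eq in QG2.
    have [er|//] := on_curve_eqx (oG _ QG2) (oG _ QG).
    by rewrite eq er eqxx in nQ.
  have r0 : r != 0 by apply: (subgroup_y_neq0 hG x_notin_roots QG).
  apply: mono (@translate_neq_opp L a b two_neq0 q r r0) => t ht y hy tn.
  by rewrite -eq er; apply: ht => //; apply: neqx tn; eauto.
- apply: mono (translate_neq_self (oG _ QG)) => t ht y hy tn.
  by apply: ht => //; apply: neqx tn; eauto.
- apply: mono (translate_neq_self (oG _ QG')) => t ht y hy tn.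
  by rewrite eq_sym; apply: ht => //; apply: neqx tn; eauto.
Qed.

Lemma exists_distinct_translates : exists P,
  [/\ on_curve a b P, P \notin G & uniq [seq x_add Q P | Q <- G]].
Proof.
have h1 : almost_all (fun t : L => forall q, q \in xs -> t^-1 != q).
  apply: almost_all_seq => q _; exists (1 - q *: 'X) => [|t t0].
    by rewrite !hornerE /= subr0 oner_neq0.
  by rewrite !hornerE /=; apply: contraNneq => <-; rewrite mulVf // subrr.
have h2 : almost_all (fun t => forall QQ : point L * point L,
  QQ \in [seq (Q, Q') | Q <- enum_fset G, Q' <- enum_fset G] ->
    QQ.1 != QQ.2 -> forall y, on_curve a b (Some (t^-1, y)) ->
    t^-1 \notin xs -> x_add QQ.1 (Some (t^-1, y)) != x_add QQ.2 (Some (t^-1, y))).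
  apply: almost_all_seq => _ /allpairsP[[Q Q'] /= [QG QG' ->]] /=.
  have [->|nQ] := eqVneq Q Q'; first by exists 1; rewrite ?hornerE ?oner_neq0.
  have [r r0 hr] := translates_distinct QG QG' nQ.
  by exists r => // t t0 rt _; apply: hr.
have [t t0 [tn td]] := almost_all_exists (almost_all_and h1 h2).
set x := t^-1 in tn td.
have [y hy] : exists y, on_curve a b (Some (x, y)).
  have /closed_rootP[y] : size ('X^2 - (x * (x - a) * (x - b))%:P : {poly L}) != 1.
    by rewrite size_XnsubC.
  by rewrite rootE !(hornerE, horner_exp) subr_eq0 => /eqP hy; exists y.
have xn : x \notin xs by apply/negP => /tn; rewrite eqxx.
exists (Some (x, y)); split=> //.
  by apply: contra xn => PG; apply: (mem_xcoords hS PG).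
rewrite map_inj_in_uniq ?fset_uniq // => Q Q' QG QG' e; apply/eqP/negPn/negP => nQ.
have QQ : (Q, Q') \in [seq (Q, Q') | Q <- enum_fset G, Q' <- enum_fset G].
  by apply/allpairsP; exists (Q, Q').
by have := td _ QQ nQ y hy xn; rewrite /= e eqxx.
Qed.

(* The difference of the two sides, divided by h^2, is a translation-invariant
   rational function of x of degree at most 2n, where n = #|S|; hence it takes each of its
   values w at p = 2n + 1 points, which forces it to be constant.  It vanishes
   at x = e. *)
Lemma translate_identity e : e \in [:: 0; a; b] ->
  'X * g 0 ^+ 2 - (e * (g 0).[e] ^+ 2 / h.[e] ^+ 2) *: h ^+ 2 =
  ('X - e%:P) * g e ^+ 2.
Proof.
move=> he; set alpha := _ / _.
(* With h(0) = 1 the product for e = 0 carries no constant. *)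
have h0 : (h.[0] = 1 :> L).
  rewrite /xpoly horner_prod big1 // => q _; by rewrite !hornerE /= subr0.
have hne : h.[e] != 0.
  apply: (horner_xpoly_neq0 hS x_notin_roots).
  by apply/negP => /(xcoords_exists hS)[y /x_notin_roots]; rewrite he.
apply/eqP; rewrite -subr_eq0.
set N := _ - _ - _.
have NE x : N.[x] = x * (g 0).[x] ^+ 2 - alpha * h.[x] ^+ 2 - (x - e) * (g e).[x] ^+ 2.
  by rewrite /N !(hornerE, horner_exp).
have [P [oP PG uP]] := exists_distinct_translates.
pose w x := N.[x] / h.[x] ^+ 2.
have wE T : on_curve a b T -> T \notin G -> w (xcoord T) =
    \prod_(Q <- G) (x_add Q T - 0) - alpha
    - \prod_(Q <- G) (x_add Q T - e) / h.[e] ^+ 2.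
  move=> oT TG; have [x [y [eT xn]]] := outside_xcoord hG hS oT TG.
  have hx := horner_xpoly_neq0 hS x_notin_roots xn.
  rewrite eT in oT *.
  rewrite !(prod_translates hG hS x_notin_roots _ oT xn) ?mem_head //.
  by rewrite h0 /w NE /=; field; rewrite hx hne.
have winv Q : Q \in G -> w (x_add Q P) = w (xcoord P).
  move=> QG.
  have oQP := ec_add_on_curve two_neq0 (subgroup_on_curve hG QG) oP.
  rewrite (wE _ oP PG) (wE _ oQP (outside_translate two_neq0 hG x_notin_roots oP PG QG)).
  by rewrite !(prod_translates_invariant two_neq0 hG hS x_notin_roots (fun z => z - _)).
set w0 := w (xcoord P) in winv.
have sN : (size N <= (size xs).*2.+1)%N.
  have s2 (q : {poly L}) : (size q <= (size xs).+1 -> size (q ^+ 2) <= (size xs).*2.+1)%N.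
    move=> sq; apply: leq_trans (size_poly_exp_leq _ _) _.
    by rewrite muln2 ltnS leq_double -subn1 leq_subLR add1n.
  have sm (c : L) q : q \is monic -> size q = (size xs).+1 ->
     size (('X - c%:P) * q ^+ 2) = (size xs).*2.+2.
    move=> mq sq; rewrite size_Mmonic ?monic_neq0 ?monicXsubC ?monic_exp //.
    have -> : size (q ^+ 2) = (size xs).*2.+1.
      by rewrite expr2 size_Mmonic ?monic_neq0 // sq addSn addnS addnn.
    by rewrite size_XsubC.
  have mon (c : L) q : q \is monic -> ('X - c%:P) * q ^+ 2 \is monic.
    by move=> mq; rewrite monicMr ?monicXsubC ?monic_exp.
  (* Both products are monic of degree 2n + 1, so their leading terms cancel and the degree drops to
     2n. *)
  have -> : N = (('X - 0%:P) * g 0 ^+ 2 - ('X - e%:P) * g e ^+ 2) - alpha *: h ^+ 2.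
    by rewrite /N subr0 addrAC.
  apply: leq_trans (size_polyD _ _) _; rewrite size_polyN geq_max; apply/andP; split.
    have m1 := mon 0 _ (monic_tpoly a b 0 xs).
    have m2 := mon e _ (monic_tpoly a b e xs).
    have s1 := sm 0 _ (monic_tpoly a b 0 xs) (size_tpoly a b 0 xs).
    have s3 := sm e _ (monic_tpoly a b e xs) (size_tpoly a b e xs).
    apply/leq_sizeP => j; rewrite leq_eqVlt => /predU1P[<-|hj]; rewrite coefB.
      have c1 := monicP m1; have c2 := monicP m2.
      by rewrite !lead_coefE s1 s3 /= in c1 c2; rewrite c1 c2 subrr.
    by rewrite !nth_default ?subrr // ?s1 ?s3.
  by apply: leq_trans (size_scale_leq _ _) _; apply/s2/size_xpoly_leq.
have sh : (size (h ^+ 2) <= (size xs).*2.+1)%N.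
  apply: leq_trans (size_poly_exp_leq _ _) _.
  by rewrite muln2 ltnS leq_double -subn1 leq_subLR add1n size_xpoly_leq.
have Nw : N = w0 *: h ^+ 2.
  apply/eqP; rewrite -subr_eq0; apply/negPn/negP => nz.
  have rt : all (root (N - w0 *: h ^+ 2)) [seq x_add Q P | Q <- G].
    apply/allP => _ /mapP[Q QG ->]; rewrite rootE hornerD hornerN hornerZ horner_exp.
    have oQP := ec_add_on_curve two_neq0 (subgroup_on_curve hG QG) oP.
    have nQP := outside_translate two_neq0 hG x_notin_roots oP PG QG.
    have [x [y [eT xn]]] := outside_xcoord hG hS oQP nQP.
    rewrite -(winv Q QG) /w eT /= divfK ?subrr //.
    by rewrite expf_neq0 // (horner_xpoly_neq0 hS x_notin_roots xn).
  have := max_poly_roots nz rt uP; rewrite size_map.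
  have -> : size G = p by case: hG.
  rewrite (subgroup_card hG hS) ltnNge => /negP; apply.
  apply: leq_trans (size_polyD _ _) _; rewrite size_polyN geq_max sN /=.
  by apply: leq_trans (size_scale_leq _ _) _.
have : N.[e] = 0.
  by rewrite NE subrr mul0r subr0 /alpha divfK ?subrr // expf_neq0.
rewrite Nw hornerZ horner_exp => /eqP; rewrite mulf_eq0 expf_eq0 (negbTE hne) andbF orbF.
by move=> /eqP ->; rewrite scale0r.
Qed.

End TranslateIdentity.

(** * Galois descent *)

Section AutomorphismExtension.
Variables (K : fieldType) (L : closedFieldType) (iota : {rmorphism K -> L}).
Hypothesis hclosure : is_algebraic_closure iota.

(* The graph of a ring morphism over K from a K-subalgebra of L to L. *)
Definition morphism_graph (Gr : L -> L -> Prop) : Prop :=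
  [/\ forall t, Gr 0 t -> t = 0,
      forall c, Gr (iota c) (iota c),
      forall x x' y y', Gr x x' -> Gr y y' -> Gr (x - y) (x' - y')
    & forall x x' y y', Gr x x' -> Gr y y' -> Gr (x * y) (x' * y')].

Definition poly_graph (Gr : L -> L -> Prop) (q q' : {poly L}) : Prop :=
  forall i, Gr q`_i q'`_i.

Section Graph.
Variables (Gr : L -> L -> Prop) (hGr : morphism_graph Gr).

Lemma graph0 : Gr 0 0.
Proof. by case: hGr => _ hc _ _; rewrite -(rmorph0 iota). Qed.

Lemma graph1 : Gr 1 1.
Proof. by case: hGr => _ hc _ _; rewrite -(rmorph1 iota). Qed.

Lemma graphD x x' y y' : Gr x x' -> Gr y y' -> Gr (x + y) (x' + y').
Proof.
case: hGr => _ _ hs _ hx hy; rewrite -[y]opprK -[y']opprK -[- y]sub0r -[- y']sub0r.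
exact: (hs _ _ _ _ hx (hs _ _ _ _ graph0 hy)).
Qed.

Lemma graph_functional x x' x'' : Gr x x' -> Gr x x'' -> x' = x''.
Proof.
case: hGr => h0 _ hs _ h1 h2; apply/eqP; rewrite -subr_eq0; apply/eqP/h0.
by rewrite -(subrr x); apply: hs.
Qed.

Lemma graph_sum (I : Type) (r : seq I) (F F' : I -> L) :
  (forall i, Gr (F i) (F' i)) -> Gr (\sum_(i <- r) F i) (\sum_(i <- r) F' i).
Proof.
move=> h; elim: r => [|i r IH]; first by rewrite !big_nil; apply: graph0.
by rewrite !big_cons; apply: graphD.
Qed.

Lemma poly_graphB q q' r r' :
  poly_graph Gr q q' -> poly_graph Gr r r' -> poly_graph Gr (q - r) (q' - r').
Proof. by case: hGr => _ _ hs _ h1 h2 i; rewrite !coefB; apply: hs. Qed.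

Lemma poly_graphM q q' r r' :
  poly_graph Gr q q' -> poly_graph Gr r r' -> poly_graph Gr (q * r) (q' * r').
Proof.
case: hGr => _ _ _ hm h1 h2 i; rewrite !coefM.
by apply: graph_sum => j; apply: hm.
Qed.

Lemma poly_graphC c c' : Gr c c' -> poly_graph Gr c%:P c'%:P.
Proof. by move=> h i; rewrite !coefC; case: eqP => // _; apply: graph0. Qed.

Lemma poly_graphXn n : poly_graph Gr 'X^n 'X^n.
Proof. by move=> i; rewrite coefXn; case: eqP => _; [apply: graph1 | apply: graph0]. Qed.

Lemma poly_graph_map (m : {poly K}) : poly_graph Gr (map_poly iota m) (map_poly iota m).
Proof. by case: hGr => _ hc _ _ i; rewrite coef_map; apply: hc. Qed.

Lemma graph_map_horner (m : {poly K}) x x' :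
  Gr x x' -> Gr (map_poly iota m).[x] (map_poly iota m).[x'].
Proof.
case: hGr => _ hc _ hm hx; elim/poly_ind: m => [|m c IH].
  by rewrite !rmorph0 !horner0; apply: graph0.
rewrite !rmorphD !rmorphM /= map_polyX map_polyC !hornerE /=.
by apply: graphD => //; apply: hm.
Qed.

Lemma poly_graph_size q q' : poly_graph Gr q q' -> (size q' <= size q)%N.
Proof.
case: hGr => h0 _ _ _ hq; apply/leq_sizeP => j hj.
by have := hq j; rewrite (nth_default 0 hj) => /h0.
Qed.

(* If m(x) = 0 with m(0) <> 0 then 1/x is a polynomial in x over K. *)
Lemma graph_inv x x' : Gr x x' -> x != 0 -> exists y, Gr x^-1 y.
Proof.
move=> hx x0; have [m m0 rm] := hclosure x.
elim/poly_ind: m m0 rm => [|m c IH]; first by rewrite eqxx.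
rewrite rmorphD rmorphM /= map_polyX map_polyC rootE !hornerE /=.
have [->|c0] := eqVneq c 0.
  rewrite polyC0 !addr0 => m0 /=; rewrite rmorph0 addr0 mulf_eq0 (negbTE x0) orbF.
  by apply: IH; apply: contraNneq m0 => ->; rewrite mul0r.
move=> _ /eqP e; case: hGr => _ hc _ hm.
exists (iota (- c^-1) * (map_poly iota m).[x']).
have -> : x^-1 = iota (- c^-1) * (map_poly iota m).[x].
  apply: (mulIf x0); rewrite mulVf // -mulrA.
  move/eqP: e; rewrite addr_eq0 => /eqP ->.
  by rewrite -rmorphN -rmorphM mulrNN mulVf // rmorph1.
by apply: hm => //; apply: graph_map_horner.
Qed.

(** The minimal polynomial of z over the domain of [Gr], a field by [graph_inv], together with its
    image. *)
Definition minimal_pair (z : L) (f f' : {poly L}) : Prop :=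
  [/\ poly_graph Gr f f', f \is monic, root f z
    & forall q q', poly_graph Gr q q' -> q != 0 -> root q z -> (size f <= size q)%N].

Lemma minimal_pair_exists z : exists f f', minimal_pair z f f'.
Proof.
have [m m0 rm] := hclosure z.
pose C n := exists q q', [/\ poly_graph Gr q q', q != 0, root q z & size q = n].
have [n Cn nmin] : exists2 n, C n & forall j, C j -> (n <= j)%N.
  have : C (size (map_poly iota m)).
    exists (map_poly iota m), (map_poly iota m); split=> //; last by rewrite map_poly_eq0.
    exact: poly_graph_map.
  move: (size _) => n0; elim/ltn_ind: n0 => n IH Cn.
  have [[j Cj jn]|nj] := boolp.EM (exists2 j, C j & (j < n)%N); first exact: IH jn Cj.
  exists n => // j Cj; rewrite leqNgt; apply/negP => jn; apply: nj; by exists j.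
have [q [q' [hq q0 rq sq]]] := Cn.
have [c hc] : exists c, Gr (lead_coef q)^-1 c.
  by apply: (graph_inv (hq _)); rewrite -lead_coefE lead_coef_eq0.
have l0 : (lead_coef q)^-1 != 0 by rewrite invr_eq0 lead_coef_eq0.
exists ((lead_coef q)^-1%:P * q), (c%:P * q'); split.
- by apply: poly_graphM => //; apply: poly_graphC.
- by rewrite monicE lead_coefM lead_coefC mulVf // lead_coef_eq0.
- by rewrite rootM rq orbT.
move=> r r' hr r0 rr; rewrite mul_polyC size_scale // sq; apply: nmin.
by exists r, r'.
Qed.

Section Extend.
Variables (z w : L) (f f' : {poly L}).
Hypotheses (hf : minimal_pair z f f') (hw : root f' w).

Definition extended_graph (x x' : L) : Prop :=
  exists q q', [/\ poly_graph Gr q q', x = q.[z] & x' = q'.[w]].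

(** Makes z -> w well defined. The polynomial q is divided by f one leading term at a time, and each
    step is copied on q'; the remainder of degree below f has the root z, so it is 0 by
    minimality. *)
Lemma extended_functional q q' : poly_graph Gr q q' -> root q z -> root q' w.
Proof.
case: hf => hff fm rf fmin.
have [n] := ubnP (size q); elim: n q q' => // n IH q q' sq hq rq.
have [q0|q0] := eqVneq q 0.
  have := poly_graph_size hq; rewrite q0 size_poly0 leqn0 size_poly_eq0 => /eqP ->.
  exact: root0.
pose d := 'X^(size q - size f) : {poly L}.
(* The coefficient of q' is taken at the leading index of q, so that the two subtractions correspond
   coefficient by coefficient. *)
have hr : poly_graph Gr (q - (lead_coef q)%:P * d * f) (q' - (q'`_(size q).-1)%:P * d * f').
  apply: poly_graphB => //; apply: poly_graphM => //.
  by apply: poly_graphM; [apply: poly_graphC; apply: hq | apply: poly_graphXn].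
have sf := fmin _ _ hq q0 rq.
have lf : lead_coef f = 1 by apply/monicP.
have f0 : f != 0 by apply: monic_neq0.
have := IH _ _ _ hr; rewrite /root !hornerE /= (eqP rq) (eqP rf) (eqP hw).
rewrite !(mulr0, subr0) eqxx; apply=> //.
have qpos : (0 < size q)%N by rewrite size_poly_gt0.
apply: (@leq_trans (size q).-1.+1); last by rewrite prednK.
rewrite ltnS.
set r := _ - _; have sr : (size r <= size q)%N.
  apply: leq_trans (size_polyD _ _) _; rewrite size_polyN geq_max leqnn /=.
  rewrite -mulrA mul_polyC; apply: leq_trans (size_scale_leq _ _) _.
  by rewrite mulrC size_mulXn // subnK.
rewrite leqNgt; apply/negP => hlt.
have es : size r = size q.
  by apply/eqP; rewrite eqn_leq sr -(prednK (_ : 0 < size q)%N) // size_poly_gt0.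
have : lead_coef r = 0.
  rewrite lead_coefE es /r coefB -mulrA coefCM /d coefXnM.
  have sf0 : (0 < size f)%N by rewrite size_poly_gt0.
  have -> : ((size q).-1 < size q - size f)%N = false.
    by apply/negbTE; rewrite -leqNgt -!subn1 leq_sub2l.
  have -> : ((size q).-1 - (size q - size f) = (size f).-1)%N.
    by rewrite -!subn1 subnAC subKn.
  by rewrite -[f`_ _]/(lead_coef f) lf mulr1 subrr.
move/eqP; rewrite lead_coef_eq0 -size_poly_eq0 es size_poly_eq0.
by rewrite (negbTE q0).
Qed.

Lemma extended_morphism_graph : morphism_graph extended_graph.
Proof.
split.
- move=> t [q [q' [hq /esym/eqP e ->]]].
  by apply/eqP; apply: extended_functional hq _; rewrite /root e.
- move=> c; exists (iota c)%:P, (iota c)%:P; rewrite !hornerC; split=> //.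
  by apply: poly_graphC; case: hGr.
- move=> x x' y y' [q [q' [hq -> ->]]] [r [r' [hr -> ->]]].
  by exists (q - r), (q' - r'); rewrite !hornerE; split=> //; apply: poly_graphB.
move=> x x' y y' [q [q' [hq -> ->]]] [r [r' [hr -> ->]]].
by exists (q * r), (q' * r'); rewrite !hornerE; split=> //; apply: poly_graphM.
Qed.

Lemma extended_graph_sub x x' : Gr x x' -> extended_graph x x'.
Proof. by move=> h; exists x%:P, x'%:P; rewrite !hornerC; split=> //; apply: poly_graphC. Qed.

Lemma extended_graph_gen : extended_graph z w.
Proof. by exists 'X^1, 'X^1; rewrite !hornerE; split=> //; apply: poly_graphXn. Qed.

End Extend.

(** The coefficient 1 of f at its degree is sent to 1, so f' is not constant. *)
Lemma minimal_pair_root z f f' : minimal_pair z f f' -> exists w, root f' w.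
Proof.
case=> hf fm rf _.
have f0 : f != 0 by apply: monic_neq0.
have c1 : f'`_(size f).-1 = 1.
  by apply: (graph_functional _ graph1); rewrite -(monicP fm) lead_coefE; apply: hf.
have sf : (1 < size f)%N.
  have := max_poly_roots f0 (rs := [:: z]); rewrite /= rf; exact.
apply/closed_rootP; rewrite neq_ltn; apply/orP; right.
rewrite ltnNge; apply/negP => h; move: c1.
rewrite nth_default; first by move/esym/eqP; rewrite oner_eq0.
by apply: leq_trans h _; rewrite -ltnS prednK // (ltn_trans _ sf).
Qed.

End Graph.

Lemma total_graph_extension Gr : morphism_graph Gr ->
  exists Gt, [/\ morphism_graph Gt, forall x x', Gr x x' -> Gt x x'
    & forall z, exists w, Gt z w].
Proof.
move=> hGr.
(* Adjoining [Gr] to every X lets the union of the empty chain qualify for Zorn's lemma. *)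
pose ext (X : L * L -> Prop) x x' := X (x, x') \/ Gr x x'.
have [|A [PA Amax]] := @classical_sets.Zorn_bigcup _ (fun X => morphism_graph (ext X)).
  move=> F FP Ftot.
  have mono X Y x x' : classical_sets.subset X Y -> ext X x x' -> ext Y x x'.
    by move=> XY [/XY|]; [left | right].
  set U := classical_sets.bigcup _ _.
  have one x x' : ext U x x' -> exists2 X, morphism_graph (ext X) /\
      (F X \/ X = fun _ => False) & ext X x x'.
    case=> [[X FX Xx]|h]; first by exists X; [split; [apply: FP | left] | left].
    exists (fun _ => False); last by right.
    split; last by right.
    by case: hGr => h0 hc hs hm; split=> [t [//|/h0//]|c|x1 x1' y1 y1' [//|h1] [//|h2]
      |x1 x1' y1 y1' [//|h1] [//|h2]]; right; [apply: hc | apply: hs | apply: hm].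
  have inU X : F X \/ X = (fun _ => False) -> classical_sets.subset X U.
    by case=> [FX|->] u // Xu; exists X.
  have two x x' y y' : ext U x x' -> ext U y y' -> exists X,
      [/\ morphism_graph (ext X), classical_sets.subset X U, ext X x x' & ext X y y'].
    move=> /one[X [gX FX] hX] /one[Y [gY FY] hY].
    have [XY|YX] : classical_sets.subset X Y \/ classical_sets.subset Y X.
    - case: FX => [FX|->]; last by left.
      case: FY => [FY|->]; last by right.
      exact: Ftot.
    - by exists Y; split=> //; [apply: inU | apply: mono hX].
    - by exists X; split=> //; [apply: inU | apply: mono hY].
  split.
  - by move=> t /one[X [[h0 _ _ _] _]] /h0.
  - by move=> c; right; case: hGr.
  - move=> x x' y y' h1 h2; have [X [[_ _ hs _] XU hx hy]] := two _ _ _ _ h1 h2.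
    exact: mono XU (hs _ _ _ _ hx hy).
  - move=> x x' y y' h1 h2; have [X [[_ _ _ hm] XU hx hy]] := two _ _ _ _ h1 h2.
    exact: mono XU (hm _ _ _ _ hx hy).
exists (ext A); split=> // [x x' h|z]; first by right.
have [f [f' hf]] := minimal_pair_exists PA z.
have [w hw] := minimal_pair_root PA hf.
have hE := extended_morphism_graph PA hf hw.
have sub := @extended_graph_sub _ PA z w.
(* B contains A and the pair (z, w), so a maximal A already has z in its domain. *)
pose B (u : L * L) := extended_graph (ext A) z w u.1 u.2.
have BE : ext B = extended_graph (ext A) z w.
  apply: boolp.funext => x; apply: boolp.funext => x'; apply: boolp.propext.
  by split=> [[//|h]|h]; [apply: sub; right | left].
have [BA|nBA] := boolp.EM (classical_sets.subset B A).
  by exists w; left; apply: BA; apply: extended_graph_gen.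
case: (Amax B) => //; last by rewrite BE.
by split=> // -[x x'] h; apply: sub; left.
Qed.

Lemma automorphism_of_graph Gr :
  morphism_graph Gr -> (forall z, exists w, Gr z w) ->
  exists s : {rmorphism L -> L}, [/\ bijective s, forall c, s (iota c) = iota c
    & forall z, Gr z (s z)].
Proof.
move=> hGr /boolp.choice[s hs]; have fn := graph_functional hGr.
have [h0 hc hsub hmul] := hGr.
have sB : zmod_morphism s by move=> x y; apply: fn (hs _) (hsub _ _ _ _ (hs x) (hs y)).
have sM : monoid_morphism s.
  split; first by apply: fn (hs _) (graph1 hGr).
  by move=> x y; apply: fn (hs _) (hmul _ _ _ _ (hs x) (hs y)).
pose sm : {rmorphism L -> L} := HB.pack s
  (GRing.isZmodMorphism.Build _ _ s sB) (GRing.isMonoidMorphism.Build _ _ s sM).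
have sc c : s (iota c) = iota c by apply: fn (hs _) (hc _).
exists sm; split=> //; have inj : injective sm := fmorph_inj sm.
suff sur y : exists x, s x = y.
  have [t ht] := boolp.choice sur; exists t => // x.
  by apply: inj; rewrite /= ht.
(* For surjectivity: s permutes the finite set of roots of a polynomial over K, and y is one of
   them. *)
have [m m0 rm] := hclosure y.
have [rs hrs] := closed_field_poly_normal (map_poly iota m).
have lm : lead_coef (map_poly iota m) != 0 by rewrite lead_coef_eq0 map_poly_eq0.
have mem x : (x \in undup rs) = root (map_poly iota m) x.
  by rewrite mem_undup hrs rootZ // root_prod_XsubC.
have us : uniq (map sm (undup rs)) by rewrite (map_inj_uniq inj) undup_uniq.
have sub : {subset map sm (undup rs) <= undup rs}.
  move=> _ /mapP[x xr ->]; rewrite mem in xr; rewrite mem.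
  have e : map_poly sm (map_poly iota m) = map_poly iota m.
    by rewrite -map_poly_comp; apply: eq_map_poly => c /=; rewrite sc.
  by rewrite -e fmorph_root.
have [] := uniq_min_size us sub _; first by rewrite size_map.
by move=> _ /(_ y); rewrite mem rm => /mapP[x _ ->]; exists x.
Qed.

(** Any root w of the minimal polynomial f of z over K is the image of z under some automorphism,
    hence equals z. So f is a power (X - z)^m, and its second coefficient -m z lies in K; dividing
    by m uses characteristic 0. *)
Lemma automorphism_fixed_base : [pchar K] =i pred0 ->
  forall z, (forall s : {rmorphism L -> L}, bijective s ->
    (forall c, s (iota c) = iota c) -> s z = z) -> exists c, iota c = z.
Proof.
move=> hchar z hz.
pose D x x' := exists2 c, x = iota c & x' = iota c.
have hD : morphism_graph D.
  split.
  - by move=> t [c /esym/eqP]; rewrite fmorph_eq0 => /eqP -> ->; rewrite rmorph0.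
  - by move=> c; exists c.
  - by move=> x x' y y' [c -> ->] [d -> ->]; exists (c - d); rewrite rmorphB.
  - by move=> x x' y y' [c -> ->] [d -> ->]; exists (c * d); rewrite rmorphM.
have [f [f' hf]] := minimal_pair_exists hD z.
have [hff fm rf _] := hf.
have ff : f' = f by apply/polyP => i; have [c -> ->] := hff i.
rewrite {f'}ff in hf hff.
have [rs frs] := closed_field_poly_normal f.
rewrite (monicP fm) scale1r in frs.
have all_z w : w \in rs -> w = z.
  move=> wrs; have hw : root f w by rewrite frs root_prod_XsubC.
  have [Gt [hGt sub tot]] := total_graph_extension (extended_morphism_graph hD hf hw).
  have [s [sbij sc sG]] := automorphism_of_graph hGt tot.
  have -> : w = s z.
    by apply: (graph_functional hGt _ (sG z)); apply/sub/(extended_graph_gen hD).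
  exact: hz.
have zrs : z \in rs by rewrite -root_prod_XsubC -frs.
have rsE : rs = nseq (size rs) z by apply/all_pred1P/allP => w /all_z ->; rewrite /= eqxx.
have sz : size rs != 0%N by apply: contraTneq zrs => /size0nil ->.
have n0 : (size rs)%:R != 0 :> K by rewrite (GRing.pcharf0P K).1.
have [c ec _] := hff (size rs).-1.
move: ec; rewrite frs coefPn_prod_XsubC // rsE.
have -> : \sum_(w <- nseq (size rs) z) w = (size rs)%:R * z.
  by rewrite big_nseq iter_addr addr0 mulr_natl.
move=> ec; exists (- c / (size rs)%:R).
rewrite fmorph_div rmorphN rmorph_nat /= -ec opprK mulrC mulKf //.
by rewrite -(rmorph_nat iota) fmorph_eq0.
Qed.
End AutomorphismExtension.

(** * Reduction *)

Section Fractions.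
Local Open Scope quotient_scope.
Lemma tofrac_surj (R : idomainType) (c : {fraction R}) : exists x y, y != 0 /\
  c = tofrac x / tofrac y.
Proof.
elim/quotW: c => -[[x y] /= y0]; exists x, y; split=> //.
have ty : tofrac y != 0 by rewrite tofrac_eq0.
apply: (mulIf ty); rewrite divfK //; unlock FracField.tofrac.
rewrite -[LHS]FracField.pi_mul /FracField.mulf.
apply/eqmodP; rewrite /= FracField.equivfE /= !numden_Ratio ?mulr1 ?mul1r ?oner_neq0 //=.
by rewrite mulrC.
Qed.
End Fractions.

Section Valuation.
Variables (R : idomainType) (pi : R) (k : fieldType) (red : {rmorphism R -> k}).
Variables (L : fieldType) (iota : {rmorphism {fraction R} -> L}) (v : L -> rat).
Hypothesis hdvr : is_dvr pi.
Hypothesis hres : is_residue_map pi red.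
Hypothesis hv : is_valuation_extension pi (fun r : R => iota (tofrac r)) v.

Local Notation f := (iota \o @tofrac R).

Definition vint (z : L) : bool := (z == 0) || (0 <= v z).
Definition vmax (z : L) : bool := (z == 0) || (0 < v z).

Lemma vM x y : x != 0 -> y != 0 -> v (x * y) = v x + v y.
Proof. by case: hv => h _ _; apply: h. Qed.

Lemma v_base u n : u \is a GRing.unit -> v (f (u * pi ^+ n)) = n%:R.
Proof. by case: hv => _ _ h uu; exact: (h u n uu). Qed.

Lemma v1 : v 1 = 0.
Proof. by have := v_base 0 (unitr1 R); rewrite expr0 mulr1 rmorph1. Qed.

Lemma vN x : v (- x) = v x.
Proof.
have N1 : (-1 : L) != 0 by rewrite oppr_eq0 oner_neq0.
have : v (-1) + v (-1) = 0 by rewrite -vM // mulrNN mulr1 v1.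
rewrite -mulr2n => /eqP; rewrite mulrn_eq0 /= => /eqP vN1.
have [->|x0] := eqVneq x 0; first by rewrite oppr0.
by rewrite -mulN1r vM // vN1 add0r.
Qed.

Lemma vV x : x != 0 -> v x^-1 = - v x.
Proof.
by move=> x0; apply/eqP; rewrite -addr_eq0 -vM ?invr_eq0 // mulVf // v1.
Qed.

Lemma vint0 : vint 0. Proof. by rewrite /vint eqxx. Qed.
Lemma vmax0 : vmax 0. Proof. by rewrite /vmax eqxx. Qed.
Lemma vint1 : vint 1. Proof. by rewrite /vint v1 lexx orbT. Qed.

Lemma vmax1 : vmax 1 = false.
Proof. by rewrite /vmax v1 ltxx oner_eq0. Qed.

Lemma vmaxW z : vmax z -> vint z.
Proof. by case/orP => [z0|/ltW vz]; apply/orP; [left | right]. Qed.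

Lemma vintN z : vint (- z) = vint z.
Proof. by rewrite /vint oppr_eq0 vN. Qed.

Lemma vmaxN z : vmax (- z) = vmax z.
Proof. by rewrite /vmax oppr_eq0 vN. Qed.

Lemma vD_ge x y : x != 0 -> y != 0 -> x + y != 0 -> Num.min (v x) (v y) <= v (x + y).
Proof. by case: hv => _ h _; apply: h. Qed.

Lemma vintD x y : vint x -> vint y -> vint (x + y).
Proof.
rewrite /vint; have [->|x0 /=] := eqVneq x 0; first by rewrite add0r.
have [->|y0 /=] := eqVneq y 0; first by rewrite addr0 (negbTE x0).
move=> hx hy; have [//|xy0 /=] := eqVneq (x + y) 0.
by apply: le_trans (vD_ge x0 y0 xy0); rewrite le_min hx.
Qed.

Lemma vmaxD x y : vmax x -> vmax y -> vmax (x + y).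
Proof.
rewrite /vmax; have [->|x0 /=] := eqVneq x 0; first by rewrite add0r.
have [->|y0 /=] := eqVneq y 0; first by rewrite addr0 (negbTE x0).
move=> hx hy; have [//|xy0 /=] := eqVneq (x + y) 0.
by apply: lt_le_trans (vD_ge x0 y0 xy0); rewrite lt_min hx.
Qed.

Lemma vintM x y : vint x -> vint y -> vint (x * y).
Proof.
rewrite /vint mulf_eq0; have [//|x0 /=] := eqVneq x 0.
by have [//|y0 /= hx hy] := eqVneq y 0; rewrite vM // addr_ge0.
Qed.

Lemma vmaxM x y : vmax x -> vint y -> vmax (x * y).
Proof.
rewrite /vint /vmax mulf_eq0; have [//|x0 /=] := eqVneq x 0.
by have [//|y0 /= hx hy] := eqVneq y 0; rewrite vM // ltr_wpDr.
Qed.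

Lemma vmaxB x y : vmax x -> vmax y -> vmax (x - y).
Proof. by move=> hx hy; rewrite vmaxD // vmaxN. Qed.

Lemma vintB x y : vint x -> vint y -> vint (x - y).
Proof. by move=> hx hy; rewrite vintD // vintN. Qed.

Lemma vint_base r : vint (f r).
Proof.
have [->|r0] := eqVneq r 0; first by rewrite rmorph0 vint0.
case: hdvr => _ _ /(_ r r0)[u [n [uu ->]]].
by rewrite /vint v_base // ler0n orbT.
Qed.

(** The valuation ring meets the fraction field in R: a fraction is a unit times pi^(n - m), and
    integrality says m <= n, so the truncated difference is exact. *)
Lemma vint_descent (c : {fraction R}) : vint (iota c) -> exists r, tofrac r = c.
Proof.
have [x [y [y0 ->]]] := tofrac_surj c.
have [->|x0 hc] := eqVneq x 0; first by exists 0; rewrite tofrac0 mul0r.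
case: hdvr => pi0 _ dv.
have [u [n [uu ex]]] := dv x x0; have [w [m [uw ey]]] := dv y y0.
have fx : iota (tofrac x) != 0 by rewrite fmorph_eq0 tofrac_eq0.
have fy : iota (tofrac y) != 0 by rewrite fmorph_eq0 tofrac_eq0.
move: hc; rewrite fmorph_div /vint mulf_eq0 invr_eq0 (negbTE fx) (negbTE fy) /=.
rewrite vM ?invr_eq0 // vV //.
have -> : v (iota (tofrac x)) = n%:R by rewrite ex; apply: v_base.
have -> : v (iota (tofrac y)) = m%:R by rewrite ey; apply: v_base.
rewrite subr_ge0 ler_nat => mn.
exists (u / w * pi ^+ (n - m)).
have ty : tofrac y != 0 by rewrite tofrac_eq0.
apply: (mulIf ty); rewrite divfK // -tofracM ex ey; congr tofrac.
rewrite -[in RHS](subnK mn) exprD; rewrite -[RHS]mulr1 -(divrr uw); ring.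
Qed.

Lemma vmax_red r : vmax (f r) -> red r = 0.
Proof.
have [->|r0] := eqVneq r 0; first by rewrite !rmorph0.
case: hdvr => pi0 _ /(_ r r0)[u [[|n] [uu ->]]] h.
  move: h; rewrite /vmax v_base // ltxx orbF fmorph_eq0 tofrac_eq0 mulf_eq0.
  by rewrite expr0 oner_eq0 orbF => /eqP u0; rewrite u0 unitr0 in uu.
by case: hres => _ hr; apply/hr; exists (u * pi ^+ n); rewrite exprSr mulrA.
Qed.

Lemma red_unit r : red r != 0 -> r \is a GRing.unit.
Proof.
move=> h; have r0 : r != 0 by apply: contraNneq h => ->; rewrite rmorph0.
case: hdvr => pi0 _ /(_ r r0)[u [[|n] [uu er]]]; first by rewrite er expr0 mulr1.
case/negP: h; apply/eqP; case: hres => _ hr; apply/hr.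
by exists (u * pi ^+ n); rewrite er exprSr mulrA.
Qed.

Lemma vmax_inv x : x != 0 -> v x < 0 -> vmax x^-1.
Proof. by move=> x0 vx; rewrite /vmax vV // oppr_gt0 vx orbT. Qed.

Lemma vint_neg x : x != 0 -> v x < 0 -> vint x = false.
Proof. by move=> x0 vx; rewrite /vint (negbTE x0) leNgt vx. Qed.

(** If 1 - t had positive valuation, then 1 = (1 - t) + t would lie in the maximal ideal. *)
Lemma v_one_sub t : vmax t -> 1 - t != 0 /\ vint (1 - t)^-1.
Proof.
move=> ht; have n0 : 1 - t != 0.
  by apply: contraTneq ht => /eqP; rewrite subr_eq0 => /eqP <-; rewrite vmax1.
split=> //; rewrite /vint vV // oppr_ge0 leNgt; apply/orP; right; apply/negP => hpos.
have : vmax ((1 - t) + t) by apply: vmaxD => //; rewrite /vmax hpos orbT.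
by rewrite subrK vmax1.
Qed.

Lemma vmax_inv_sub x e : x != 0 -> v x < 0 -> vint e -> vmax (x - e)^-1.
Proof.
move=> x0 vx he.
have ht : vmax (x^-1 * e) by apply: vmaxM => //; apply: vmax_inv.
have [n0 hi] := v_one_sub ht.
have -> : x - e = x * (1 - x^-1 * e) by rewrite mulrBr mulr1 mulVKf.
by rewrite invfM vmaxM // vmax_inv.
Qed.

Definition pint (q : {poly L}) := forall i, vint q`_i.
Definition pcong (q r : {poly L}) := forall i, vmax (q - r)`_i.

Lemma vint_sum (I : Type) (s : seq I) (F : I -> L) :
  (forall i, vint (F i)) -> vint (\sum_(i <- s) F i).
Proof.
move=> h; elim: s => [|i s IH]; first by rewrite big_nil vint0.
by rewrite big_cons vintD.
Qed.

Lemma vmax_sum (I : Type) (s : seq I) (F : I -> L) :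
  (forall i, vmax (F i)) -> vmax (\sum_(i <- s) F i).
Proof.
move=> h; elim: s => [|i s IH]; first by rewrite big_nil vmax0.
by rewrite big_cons vmaxD.
Qed.

Lemma pint_pcong q r : pcong q r -> pint r -> pint q.
Proof.
by move=> h hr i; rewrite -[q](subrK r) coefD vintD //; apply: vmaxW; apply: h.
Qed.

Lemma pintM q r : pint q -> pint r -> pint (q * r).
Proof. by move=> hq hr i; rewrite coefM; apply: vint_sum => j; apply: vintM. Qed.

Lemma pint1 : pint 1.
Proof. by move=> i; rewrite coef1; case: eqP; rewrite ?vint0 ?vint1. Qed.

Lemma pintX n q : pint q -> pint (q ^+ n).
Proof. by move=> h; elim: n => [|n IH]; [apply: pint1 | rewrite exprS; apply: pintM]. Qed.

Lemma pint_XsubC e : vint e -> pint ('X - e%:P).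
Proof.
move=> he i; rewrite coefB coefX coefC vintB //; case: eqP => _;
  by rewrite ?vint0 ?vint1.
Qed.

Lemma pcong_refl q : pcong q q.
Proof. by move=> i; rewrite subrr coef0 vmax0. Qed.

Lemma pcongM q q' r r' :
  pcong q q' -> pcong r r' -> pint q' -> pint r -> pcong (q * r) (q' * r').
Proof.
move=> hq hr iq ir i.
have -> : q * r - q' * r' = (q - q') * r + (r - r') * q' by ring.
by rewrite coefD vmaxD // coefM; apply: vmax_sum => j; apply: vmaxM.
Qed.

Lemma vmax_xtrans a b e q : vint a -> vint b -> vint e -> q != 0 -> v q < 0 ->
  vmax (xtrans a b e q - e).
Proof.
move=> va vb ve q0 vq; rewrite /xtrans addrC addKr mulrC vmaxM ?vmax_inv_sub //.
have vn n : vint n%:R by have := vint_base n%:R; rewrite rmorph_nat.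
rewrite /fprime; apply: vintD; last exact: vintM.
by apply: vintB; repeat apply: vintM => //; apply: vintD.
Qed.

Section ReductionOfFactors.
Variable xs : seq L.
Hypothesis xs_neg : forall q, q \in xs -> q != 0 /\ v q < 0.

Lemma pcong_xpoly : pcong (xpoly xs) 1.
Proof.
elim: xs xs_neg => [|q s IH] hs; first by rewrite /xpoly big_nil; apply: pcong_refl.
rewrite /xpoly big_cons -[X in pcong _ X](mulr1 1); have [q0 vq] := hs q (mem_head _ _).
have {}IH : pcong (xpoly s) 1 by apply: IH => r rs; apply: hs; rewrite inE rs orbT.
apply: pcongM => //; [|exact: pint1|apply: pint_pcong IH pint1].
move=> i; rewrite addrAC subrr add0r coefN vmaxN coefZ vmaxM ?vmax_inv //.
by rewrite coefX; case: eqP; rewrite ?vint0 ?vint1.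
Qed.

Lemma pcong_tpoly a b e : vint a -> vint b -> vint e ->
  pcong (tpoly a b e xs) (('X - e%:P) ^+ size xs).
Proof.
move=> va vb ve; elim: xs xs_neg => [|q s IH] hs.
  by rewrite /tpoly big_nil; apply: pcong_refl.
rewrite /tpoly big_cons /= exprS; have [q0 vq] := hs q (mem_head _ _).
have {}IH : pcong (tpoly a b e s) (('X - e%:P) ^+ size s).
  by apply: IH => r rs; apply: hs; rewrite inE rs orbT.
apply: pcongM => //; last 2 first.
- exact: pint_XsubC.
- by apply: pint_pcong IH _; apply/pintX/pint_XsubC.
move=> i.
have -> : 'X - (xtrans a b e q)%:P - ('X - e%:P) = (- (fprime a b e / (q - e)))%:P.
  by rewrite /xtrans polyCN polyCD; ring.
rewrite coefC; case: eqP => _; last exact: vmax0.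
by rewrite vmaxN -[_ / _](addKr e) addrC; apply: vmax_xtrans.
Qed.
End ReductionOfFactors.

Lemma pint_descent (q : {poly {fraction R}}) : pint (map_poly iota q) ->
  exists r, map_poly (@tofrac R) r = q.
Proof.
move=> h.
have /boolp.choice[c hc] : forall i, exists r, tofrac r = q`_i.
  by move=> i; apply: vint_descent; have := h i; rewrite coef_map.
exists (\poly_(i < size q) c i); apply/polyP => i; rewrite coef_map coef_poly.
by case: ltnP => hi /=; rewrite ?hc // nth_default // rmorph0.
Qed.

Lemma pcong_red (q r : {poly R}) :
  pcong (map_poly f q) (map_poly f r) -> map_poly red q = map_poly red r.
Proof.
move=> h; apply/polyP => i; apply/eqP; rewrite !coef_map -subr_eq0 -rmorphB /=.
by apply/eqP/vmax_red; have := h i; rewrite coefB !coef_map -rmorphB.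
Qed.

End Valuation.

(** * Forms of degree p on the curve *)

Lemma ord3P (i : 'I_3) : [\/ i = inord 0, i = inord 1 | i = inord 2].
Proof.
by case: i => [[|[|[|//]]] hi]; [apply: Or31 | apply: Or32 | apply: Or33];
  apply: val_inj; rewrite /= inordK.
Qed.

Section Forms.
Variables (A : comNzRingType) (a b : A).

Local Notation X := ('X_(inord 0) : {mpoly A[3]}).
Local Notation Y := ('X_(inord 1) : {mpoly A[3]}).
Local Notation Z := ('X_(inord 2) : {mpoly A[3]}).

(* On the curve X^3 = Z W. *)
Definition cube_form : {mpoly A[3]} :=
  Y ^+ 2 + (a + b) *: X ^+ 2 - (a * b) *: (X * Z).

(* The monomial x^m, of pole order 2m at infinity, as a form of degree d >= 2m/3;
   the exponent of Z is a truncated difference. *)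
Definition curve_form (d : nat) (q : {poly A}) : {mpoly A[3]} :=
  \sum_(m < size q)
    q`_m *: (X ^+ (m %% 3) * cube_form ^+ (m %/ 3) * Z ^+ (d + m %/ 3 - m)).

Lemma ord_bound d s (m : 'I_s) : (2 * s.-1 <= 3 * d)%N -> (2 * m <= 3 * d)%N.
Proof. by have := ltn_ord m; lia. Qed.

Lemma dhomog_var i : ('X_i : {mpoly A[3]}) \is 1.-homog.
Proof. by rewrite dhomogX /= mdeg1. Qed.

Lemma dhomog_exp (q : {mpoly A[3]}) d e : q \is d.-homog -> q ^+ e \is (d * e).-homog.
Proof.
move=> hq; elim: e => [|e IH]; first by rewrite expr0 muln0 dhomog1.
by rewrite exprS mulnS; apply: dhomogM.
Qed.

Lemma dhomog_cube_form : cube_form \is 2.-homog.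
Proof.
have hXX : X ^+ 2 \is 2.-homog by apply: (dhomog_exp 2 (dhomog_var _)).
have hYY : Y ^+ 2 \is 2.-homog by apply: (dhomog_exp 2 (dhomog_var _)).
have hXZ : X * Z \is 2.-homog by apply: (dhomogM (dhomog_var _) (dhomog_var _)).
by apply: rpredB; [apply: rpredD => //|]; apply: rpredZ.
Qed.

(** The bound makes the truncated exponent of Z a true difference: with m = 3t + r, it gives 2t + r
    <= d. *)
Lemma dhomog_curve_form d (q : {poly A}) : (2 * (size q).-1 <= 3 * d)%N ->
  curve_form d q \is d.-homog.
Proof.
move=> hd; apply: rpred_sum => m _; apply: rpredZ.
have hm : (d = 1 * (m %% 3) + 2 * (m %/ 3) + 1 * (d + m %/ 3 - m))%N.
  have := divn_eq m 3; have := ltn_pmod m (isT : (0 < 3)%N); have := ord_bound m hd.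
  move: (m %% 3)%N (m %/ 3)%N (m : nat) => r t u; lia.
have : X ^+ (m %% 3) * cube_form ^+ (m %/ 3) * Z ^+ (d + m %/ 3 - m)
    \is (1 * (m %% 3) + 2 * (m %/ 3) + 1 * (d + m %/ 3 - m)).-homog.
  apply: dhomogM; last exact/dhomog_exp/dhomog_var.
  by apply: dhomogM; apply: dhomog_exp; [apply: dhomog_var | apply: dhomog_cube_form].
by rewrite -hm.
Qed.

Section Evaluation.
Variables (L : fieldType) (f : {rmorphism A -> L}) (w : 'I_3 -> L).

Local Notation ev q := ((map_mpoly f q).@[w]).

Lemma ev_curve_form d q : ev (curve_form d q) = \sum_(m < size q)
    f q`_m * (w (inord 0) ^+ (m %% 3) *
      (w (inord 1) ^+ 2 + f (a + b) * w (inord 0) ^+ 2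
       - f (a * b) * (w (inord 0) * w (inord 2))) ^+ (m %/ 3) *
      w (inord 2) ^+ (d + m %/ 3 - m)).
Proof.
rewrite /curve_form (raddf_sum (map_mpoly f)) (raddf_sum (meval w)) /=.
apply: eq_bigr => m _.
rewrite map_mpolyZ mevalZ !rmorphM /= !rmorphXn /= !map_mpolyX !mevalXU.
rewrite /cube_form !(rmorphB, rmorphD) /= !map_mpolyZ !mevalZ !(rmorphM, rmorphXn) /=.
by rewrite !map_mpolyX !mevalXU rmorphD !expr2.
Qed.
End Evaluation.

Lemma ev_curve_form_affine (L : fieldType) (f : {rmorphism A -> L}) d q x y :
  on_curve (f a) (f b) (Some (x, y)) ->
  (map_mpoly f (curve_form d q)).@[proj_coords (Some (x, y))] = (map_poly f q).[x].
Proof.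
move=> /= hxy; rewrite ev_curve_form /= !inordK //=.
have -> : y ^+ 2 + f (a + b) * x ^+ 2 - f (a * b) * (x * 1) = x ^+ 3.
  by rewrite hxy rmorphD rmorphM /=; ring.
rewrite (horner_coef_wide _ (size_poly _ _ : (size (map_poly f q) <= size q)%N)).
apply: eq_bigr => m _; rewrite coef_map expr1n mulr1 -exprM mulnC -exprD.
by rewrite addnC -divn_eq.
Qed.

(** At [0 : 1 : 0] only a term without X and Z survives: m = 3t with d = 2t, the monomial of maximal
    pole order 3d. *)
Lemma ev_curve_form_infinity (L : fieldType) (f : {rmorphism A -> L}) d (q : {poly A}) :
  (2 * (size q).-1 <= 3 * d)%N ->
  (map_mpoly f (curve_form d q)).@[proj_coords None] =
  if odd d then 0 else f q`_(3 * d./2).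
Proof.
move=> hd; rewrite ev_curve_form /= !inordK //=.
have -> : (1 : L) ^+ 2 + f (a + b) * 0 ^+ 2 - f (a * b) * (0 * 0) = 1 by ring.
have term (m : 'I_(size q)) :
    f q`_m * (0 ^+ (m %% 3) * 1 ^+ (m %/ 3) * 0 ^+ (d + m %/ 3 - m)) =
    if ~~ odd d && (m == 3 * d./2 :> nat) then f q`_m else 0.
  rewrite expr1n mulr1 -exprD expr0n.
  have -> : (m %% 3 + (d + m %/ 3 - m) == 0)%N = ~~ odd d && (m == 3 * d./2 :> nat).
    have := divn_eq m 3; have := ltn_pmod m (isT : (0 < 3)%N); have := ord_bound m hd.
    have := odd_double_half d.
    move: (m %% 3)%N (m %/ 3)%N (m : nat) (d./2) => r t u e.
    by case: (odd d); rewrite /= -muln2; lia.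
  by case: ifP => _; rewrite ?mulr1 ?mulr0.
rewrite (eq_bigr _ (fun m _ => term m)).
case: ifP => od /=; first by rewrite big1.
have [hlt|hge] := ltnP (3 * d./2) (size q).
  rewrite (bigD1 (Ordinal hlt)) //= eqxx big1 ?addr0 // => m.
  by rewrite -val_eqE /= => /negbTE ->.
rewrite nth_default // rmorph0 big1 // => m _.
by case: eqP => // e; have := ltn_ord m; rewrite e ltnNge hge.
Qed.

End Forms.

(** * The isogeny as a triple of forms *)

Section Triple.
Variables (A : comNzRingType) (a b : A) (n : nat).
Variables (h : {poly A}) (g : 'I_3 -> {poly A}).
Hypothesis n0 : (0 < n)%N.
Hypothesis sh : (size h <= n.+1)%N.
Hypotheses (mg : forall i, g i \is monic) (sg : forall i, size (g i) = n.+1).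

(* [x g_0^2 h : g_0 g_1 g_2 y : h^3], in forms of degree p = 2n + 1 *)
Definition isogeny_triple (i : 'I_3) : {mpoly A[3]} :=
  [:: curve_form a b (2 * n).+1 ('X * g ord0 ^+ 2 * h);
      'X_(inord 1) * curve_form a b (2 * n) (\prod_i g i);
      'X_(inord 2) * curve_form a b (2 * n) (h ^+ 3)]`_i.

Lemma size_prod_g : size (\prod_i g i) = (3 * n).+1.
Proof.
rewrite !big_ord_recl big_ord0 mulr1 !size_monicM ?monic_neq0 ?monicMl ?mg //.
by rewrite !sg; lia.
Qed.

Lemma monic_prod_g : \prod_i g i \is monic.
Proof. by apply: monic_prod => i _. Qed.

Lemma size_exp_h m : (size (h ^+ m) <= (n * m).+1)%N.
Proof.
apply: leq_trans (size_poly_exp_leq _ _) _; rewrite ltnS leq_mul2r.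
by apply/orP; right; rewrite -subn1 leq_subLR add1n.
Qed.

Lemma size_x_coordinate : (size ('X * g ord0 ^+ 2 * h)%R <= (3 * n).+2)%N.
Proof.
apply: leq_trans (size_polyMleq _ _) _.
have -> : size ('X * g ord0 ^+ 2) = (2 * n).+2.
  rewrite mulrC size_mulX ?monic_neq0 ?monic_exp ?mg // expr2.
  by rewrite size_monicM ?monic_neq0 ?mg // !sg; lia.
by rewrite addSn /=; apply: leq_trans (leq_add (leqnn _) sh) _; lia.
Qed.

Lemma isogeny_triple_homogeneous : homogeneous_triple isogeny_triple.
Proof.
exists (2 * n).+1 => i; rewrite /isogeny_triple.
have hM j (q : {poly A}) : (size q <= (3 * n).+1)%N ->
    'X_j * curve_form a b (2 * n) q \is (2 * n).+1.-homog.
  move=> sq; have hq : curve_form a b (2 * n) q \is (2 * n).-homog.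
    by apply: dhomog_curve_form; move: sq; move: (size q) => s; lia.
  exact: (dhomogM (dhomog_var A j) hq).
have [] := ord3P i => ->; rewrite inordK //=.
- apply: dhomog_curve_form; move: size_x_coordinate; move: (size _) => s; lia.
- by apply: hM; rewrite size_prod_g.
by apply: hM; apply: leq_trans (size_exp_h _) _; rewrite mulnC.
Qed.

Section Evaluation.
Variables (L : fieldType) (f : {rmorphism A -> L}).

Lemma isogeny_triple_affine x y i :
  on_curve (f a) (f b) (Some (x, y)) ->
  eval_at f isogeny_triple (Some (x, y)) i =
  [:: x * (map_poly f (g ord0)).[x] ^+ 2 * (map_poly f h).[x];
      y * \prod_i (map_poly f (g i)).[x]; (map_poly f h).[x] ^+ 3]`_i.
Proof.
move=> hxy; rewrite /eval_at /isogeny_triple.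
have [] := ord3P i => ->; rewrite inordK //=.
- by rewrite ev_curve_form_affine // !rmorphM /= map_polyX !hornerE /=; ring.
- rewrite rmorphM mevalM /= ev_curve_form_affine // map_mpolyX mevalXU /= inordK //=.
  by rewrite rmorph_prod horner_prod.
rewrite rmorphM mevalM /= ev_curve_form_affine // map_mpolyX mevalXU /= inordK //=.
by rewrite mul1r rmorphXn /= horner_exp.
Qed.

(** The first form vanishes because its degree 2n + 1 is odd. In the second, the product of the g_i
    has degree exactly 3n, the extreme case for forms of degree 2n, and its leading coefficient 1 is
    the value. *)
Lemma isogeny_triple_infinity i :
  eval_at f isogeny_triple None i = proj_coords (L := L) None i.
Proof.
rewrite /eval_at /isogeny_triple.
have [] := ord3P i => ->; rewrite /= inordK //=.
- rewrite ev_curve_form_infinity /= ?mul2n ?odd_double //.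
  by move: size_x_coordinate; move: (size _) => s; lia.
- rewrite rmorphM mevalM /= ev_curve_form_infinity; last by rewrite size_prod_g; lia.
  rewrite map_mpolyX mevalXU /= inordK //=.
  rewrite mul2n odd_double doubleK /= mul1r.
  have -> : (\prod_i g i)`_(3 * n) = 1; last by rewrite rmorph1.
  by rewrite -[RHS](monicP monic_prod_g) lead_coefE size_prod_g.
by rewrite rmorphM mevalM /= map_mpolyX mevalXU /= inordK //= mul0r.
Qed.

End Evaluation.
End Triple.

(** A singular point with Z nonzero has Y = 0 and a multiple root of the cubic, against the
    distinctness of 0, a, b. If Z = 0, the equation forces X = 0 and the Z-derivative then forces Y
    = 0. *)
Lemma weierstrass_nonsingular (L : fieldType) (a b : L) :
  (2 : L) != 0 -> a != 0 -> b != 0 -> a != b -> nonsingular a b.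
Proof.
move=> two_neq0 a0 b0 ab w [i wi] hw.
have [//|nex] := boolp.EM (exists i, (weierstrass_cubic a b)^`M(i).@[w] != 0).
have {}nex j : (weierstrass_cubic a b)^`M(j).@[w] = 0.
  by apply/eqP/negPn/negP => h; apply: nex; exists j.
have nX := nex (inord 0); have nY := nex (inord 1); have nZ := nex (inord 2).
move: hw nX nY nZ; rewrite /weierstrass_cubic !(mderivB, mderivD, mderivZ, mderivM, expr2).
have dX (j l : 'I_3) : ('X_j : {mpoly L[3]})^`M(l).@[w] = (j == l)%:R.
  rewrite mderivX mevalZ mnm1E; case: eqP => [->|_]; last by rewrite mul0r.
  have -> : (U_(l) - U_(l))%MM = 0%MM :> 'X_{1.. 3}.
    by apply/mnmP => u; rewrite mnmBE subnn mnm0E.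
  by rewrite mpolyX0 meval1 mulr1.
rewrite !(mevalB, mevalD, mevalZ, mevalM, dX) !mevalXU -!val_eqE /= !inordK //=.
set X := w (inord 0); set Y := w (inord 1); set Z := w (inord 2).
rewrite !(mul1r, mul0r, mulr0, mulr1, addr0, add0r, subr0, sub0r).
move=> hw hX hY hZ.
exfalso.
have Z0 : Z = 0.
  apply/eqP/negPn/negP => Z0.
  have Y0 : Y = 0.
    have : 2 * Z * Y = 0 by rewrite -hY; ring.
    by move/eqP; rewrite !mulf_eq0 (negbTE two_neq0) (negbTE Z0) => /eqP.
  have : X * (X - a * Z) * (X - b * Z) = 0 by rewrite -[RHS]oppr0 -hw Y0; ring.
  move/eqP; rewrite !mulf_eq0 -orbA => /or3P[]/eqP E.
  - have : a * b * Z * Z = 0 by rewrite -[RHS]oppr0 -hX E; ring.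
    by move/eqP; rewrite !mulf_eq0 (negbTE a0) (negbTE b0) (negbTE Z0).
  - have EX : X = a * Z by apply/eqP; rewrite -subr_eq0 E.
    have : a * (a - b) * Z * Z = 0 by rewrite -[RHS]oppr0 -hX EX; ring.
    by move/eqP; rewrite !mulf_eq0 subr_eq0 (negbTE a0) (negbTE ab) (negbTE Z0).
  have EX : X = b * Z by apply/eqP; rewrite -subr_eq0 E.
  have : b * (a - b) * Z * Z = 0 by rewrite -hX EX; ring.
  by move/eqP; rewrite !mulf_eq0 subr_eq0 (negbTE b0) (negbTE ab) (negbTE Z0).
have X0 : X = 0.
  apply/eqP; have : X ^+ 3 = 0 by rewrite -[RHS]oppr0 -hw Z0; ring.
  by move/eqP; rewrite expf_eq0.
have Y0 : Y = 0.
  apply/eqP; have : Y ^+ 2 = 0 by rewrite -hZ X0 Z0; ring.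
  by move/eqP; rewrite expf_eq0.
by have [] := ord3P i => e; rewrite e -/X -/Y -/Z ?X0 ?Y0 ?Z0 eqxx in wi.
Qed.

(** * The differential *)

Lemma coefM_top (L : nzRingType) (q r : {poly L}) i j :
  (size q <= i.+1)%N -> (size r <= j.+1)%N -> (q * r)`_(i + j) = q`_i * r`_j.
Proof.
move=> sq sr; have hi : (i < (i + j).+1)%N by rewrite ltnS leq_addr.
rewrite coefM (bigD1 (Ordinal hi)) //= addKn.
rewrite big1 ?addr0 // => l; rewrite -val_eqE /= => nl.
have [li|il] := ltnP l i.
  by rewrite [r`__]nth_default ?mulr0 //; apply: leq_trans sr _; lia.
by rewrite nth_default ?mul0r //; apply: leq_trans sq _; lia.
Qed.

Section PullbackIdentity.
Variables (L : closedFieldType) (h g0 g1 g2 : {poly L}) (a b alpha beta : L) (n : nat).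
Hypotheses (mg0 : g0 \is monic) (mg1 : g1 \is monic) (mg2 : g2 \is monic).
Hypotheses (sg0 : size g0 = n.+1) (sg1 : size g1 = n.+1) (sg2 : size g2 = n.+1).
Hypothesis sh : size h = n.+1.
Hypothesis c01 : coprimep g0 g1.
Hypothesis c02 : coprimep g0 g2.
Hypothesis c12 : coprimep g1 g2.
Hypothesis ea : 'X * g0 ^+ 2 - alpha *: h ^+ 2 = ('X - a%:P) * g1 ^+ 2.
Hypothesis eb : 'X * g0 ^+ 2 - beta *: h ^+ 2 = ('X - b%:P) * g2 ^+ 2.

(* The numerator of the derivative of x g0^2 / h^2 is also that of
   (x - a) g1^2 / h^2 and of (x - b) g2^2 / h^2, so all three of g0, g1, g2
   divide it. *)
Lemma pullback_identity :
  ('X * g0 ^+ 2)^`() * h - 2 *: ('X * g0 ^+ 2 * h^`()) =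
  lead_coef h *: (g0 * g1 * g2).
Proof.
set U := _ - _.
(* Adding a constant multiple of h^2 to the numerator does not change the derivative of its quotient
   by h^2, so U can be computed from any of the three expressions. *)
have numE c e (q : {poly L}) : 'X * g0 ^+ 2 - c *: h ^+ 2 = ('X - e%:P) * q ^+ 2 -> 
    U = q * (q * h + 2 *: (('X - e%:P) * (q^`() * h - q * h^`()))).
  move=> /eqP; rewrite subr_eq => /eqP E.
  rewrite /U E !(derivXsubC, derivD, derivZ, derivM, expr2).
  by rewrite -!mul_polyC; ring.
have d1 : g1 %| U by rewrite (numE _ _ _ ea) dvdp_mulr.
have d2 : g2 %| U by rewrite (numE _ _ _ eb) dvdp_mulr.
have d0 : g0 %| U.
  have -> : U = g0 * (g0 * h + 2 *: ('X * (g0^`() * h - g0 * h^`()))).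
    by rewrite /U !(derivM, derivX, expr2) -!mul_polyC; ring.
  exact: dvdp_mulr.
have dU : g0 * g1 * g2 %| U.
  rewrite Gauss_dvdp; last by rewrite coprimepMl c02 c12.
  by rewrite Gauss_dvdp // d0 d1 d2.
have mG : g0 * g1 * g2 \is monic by rewrite !monicMl.
have sG : size (g0 * g1 * g2) = (3 * n).+1.
  rewrite size_Mmonic ?monic_neq0 ?monicMl // size_Mmonic ?monic_neq0 // sg0 sg1 sg2 /=.
  by clear -n; lia.
have mX : 'X * g0 ^+ 2 \is monic by rewrite monicMl ?monicX ?monic_exp.
have sX : size ('X * g0 ^+ 2) = (2 * n).+2.
  rewrite size_Mmonic ?polyX_eq0 ?monic_exp // size_polyX expr2.
  by rewrite size_Mmonic ?monic_neq0 // sg0; clear -n; lia.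
have sd (q : {poly L}) m : (size q <= m.+1)%N -> (size q^`() <= m)%N.
  by move=> sq; apply/leq_sizeP => j hj; rewrite coef_deriv nth_default ?mul0rn //; apply: leq_trans sq _.
have UE : U = ('X * g0 ^+ 2)^`() * h - g0 ^+ 2 * (2 *: ('X * h^`())).
  by rewrite /U -!mul_polyC; ring.
have sg : size (g0 ^+ 2) = (2 * n).+1.
  by rewrite expr2 size_Mmonic ?monic_neq0 // sg0 addSn /= addnS addnn -mul2n.
have sXh : (size (2 *: ('X * h^`())) <= n.+1)%N.
  apply: leq_trans (size_scale_leq _ _) _; rewrite mulrC.
  by apply/leq_sizeP => -[|j] hj; rewrite coefMX //= nth_default // sd ?sh.
have sP' : (size ('X * g0 ^+ 2)^`() <= (2 * n).+1)%N by apply: sd; rewrite sX.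
(* The top coefficient is (2n + 1) - 2n = 1 times that of h. *)
have cU : U`_(2 * n + n) = lead_coef h.
  rewrite UE coefB (coefM_top sP') ?sh // [(g0 ^+ 2 * _)`__]coefM_top ?sg //.
  have -> : (g0 ^+ 2)`_(2 * n) = 1.
    by rewrite -[RHS](monicP (monic_exp 2 mg0)) lead_coefE sg.
  have top : ('X * g0 ^+ 2)`_(2 * n).+1 = 1.
    by rewrite -[RHS](monicP mX) lead_coefE sX.
  have cX : ('X * h^`())`_n = h`_n *+ n.
    by rewrite coefXM coef_deriv; case: (n).
  rewrite coef_deriv top lead_coefE sh coefZ cX /= -[h`_n *+ n]mulr_natl -[(2 * n).+1%:R]natr1 natrM.
  ring.
have sU : (size U <= (3 * n).+1)%N.
  rewrite UE; apply: leq_trans (size_polyD _ _) _; rewrite size_polyN geq_max.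
  apply/andP; split; apply: leq_trans (size_polyMleq _ _) _.
    by rewrite sh addnS /=; apply: leq_trans (leq_add sP' (leqnn _)) _; clear -n; lia.
  by rewrite sg addSn /=; apply: leq_trans (leq_add (leqnn _) sXh) _; clear -n; lia.
have /dvdpP[c eU] := dU.
have [U0|U0] := eqVneq U 0.
  by rewrite U0 -cU U0 coef0 scale0r.
(* U has degree at most 3n and is divisible by a monic polynomial of degree 3n, so the cofactor is a
   constant, which [cU] identifies. *)
have c0 : c != 0 by apply: contraNneq U0 => c0; rewrite eU c0 mul0r.
have sc : size c = 1%N.
  have : (0 < size c)%N by rewrite size_poly_gt0.
  move: sU; rewrite eU size_Mmonic // sG.
  by move: (size c) => m; clear -n; lia.
have /size_poly1P[d _ ed] : size c == 1%N by rewrite sc.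
rewrite eU ed mul_polyC; congr (_ *: _); rewrite -cU eU ed mul_polyC coefZ.
have -> : (g0 * g1 * g2)`_(2 * n + n) = 1; last by rewrite mulr1.
by rewrite -[RHS](monicP mG) lead_coefE sG; congr (_`_ _); clear -n; lia.
Qed.
End PullbackIdentity.

Section Differentials.
Variables (K KE : fieldType) (j : {rmorphism K -> KE}) (Omega : lmodType KE).
Variable d : KE -> Omega.
Hypothesis hd : is_derivation j d.

Lemma derivation_horner (q : {poly K}) x :
  d (map_poly j q).[x] = (map_poly j q^`()).[x] *: d x.
Proof.
case: hd => dD dM dC; elim/poly_ind: q => [|q c IH].
  by rewrite deriv0 !rmorph0 !horner0 scale0r -(rmorph0 j) dC.
rewrite derivD derivM derivX derivC addr0 mulr1 !(rmorphD, rmorphM) /=.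
rewrite !map_polyX !map_polyC !hornerE /= dD dC addr0 dM IH scalerA -scalerDl.
by congr (_ *: _); ring.
Qed.

Lemma derivation_div u w : w != 0 -> d (u / w) = w^-1 *: (d u - (u / w) *: d w).
Proof.
case: hd => dD dM dC w0; rewrite -{2}[u](divfK w0) (dM (u / w)).
by rewrite addrAC subrr add0r scalerA mulVf // scale1r.
Qed.

(** With N = x g_1^2, one has d(N / h^2) = (N' h - 2 N h') / h^3 dx. The hypothesis turns the
    numerator into a multiple of the product of the g_i, which cancels against [Fy_at] and leaves
    dx/y. *)
Lemma pullback_differential (a b : K) (x y : KE) (h : {poly K}) (g : 'I_3 -> {poly K}) :
  is_function_field a b j x y -> h != 0 -> (forall i, g i != 0) ->
  ('X * g ord0 ^+ 2)^`() * h - 2 *: ('X * g ord0 ^+ 2 * h^`()) =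
    lead_coef h *: \prod_i g i ->
  pullback_dx_over_y d (Fx_at j h g x) (Fy_at j h g x y) =
  j (lead_coef h) *: (y^-1 *: d x).
Proof.
case=> hy tr _ h0 g0 hU; pose ev q := (map_poly j q).[x].
have ev0 q : q != 0 -> ev q != 0 by apply: contra => /tr ->.
have evD q r : ev (q + r) = ev q + ev r by rewrite /ev rmorphD hornerD.
have evN q : ev (- q) = - ev q by rewrite /ev rmorphN hornerN.
have evM q r : ev (q * r) = ev q * ev r by rewrite /ev rmorphM hornerM.
have evZ c q : ev (c *: q) = j c * ev q by rewrite /ev map_polyZ hornerZ.
have evX : ev 'X = x by rewrite /ev map_polyX hornerX.
have y0 : y != 0.
  suff : y ^+ 2 != 0 by rewrite expf_eq0.
  rewrite hy.
  have -> : x * (x - j a) * (x - j b) = ev ('X * ('X - a%:P) * ('X - b%:P)).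
    by rewrite !(evM, evD, evN) evX /ev !map_polyC !hornerC.
  by apply: ev0; rewrite !mulf_neq0 ?polyX_eq0 ?polyXsubC_eq0.
have p0 : ev (\prod_i g i) != 0 by apply: ev0; apply/prodf_neq0.
have hh := ev0 _ h0.
rewrite /pullback_dx_over_y /Fx_at /Fy_at -/(ev h).
have -> : \prod_i (map_poly j (g i)).[x] = ev (\prod_i g i).
  by rewrite /ev rmorph_prod horner_prod.
have -> : x * (map_poly j (g ord0)).[x] ^+ 2 = ev ('X * g ord0 ^+ 2).
  by rewrite evM evX expr2 evM.
have -> : ev h ^+ 2 = ev (h ^+ 2) by rewrite !expr2 evM.
rewrite derivation_div; last by rewrite expr2 evM mulf_neq0.
rewrite !derivation_horner -/(ev _) -/(ev _) !scalerA -scalerBl !scalerA; congr (_ *: _).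
move: hU; move: ('X * g ord0 ^+ 2) => N hU.
have hU' := congr1 ev hU; rewrite evD evN !evZ !evM rmorph_nat in hU'.
have -> : ev (h ^+ 2)^`() = 2 * (ev h * ev h^`()).
  by rewrite expr2 derivM evD !evM; ring.
rewrite expr2 !evM.
have -> : ev N^`() = (j (lead_coef h) * ev (\prod_i g i) + 2 * (ev N * ev h^`())) / ev h.
  by rewrite -hU' subrK mulfK.
by field; rewrite y0 hh p0.
Qed.
End Differentials.

(** * The isogeny *)

Lemma poly_descent (K : fieldType) (L : closedFieldType) (iota : {rmorphism K -> L}) :
  is_algebraic_closure iota -> [pchar K] =i pred0 ->
  forall q : {poly L}, (forall s : {rmorphism L -> L}, bijective s ->
    (forall c, s (iota c) = iota c) -> map_poly s q = q) ->
  exists m, map_poly iota m = q.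
Proof.
move=> hclosure hchar q hq.
have /boolp.choice[c hc] : forall i, exists c, iota c = q`_i.
  move=> i; apply: (automorphism_fixed_base hclosure hchar) => s sb sc.
  by rewrite -[in RHS](hq s sb sc) coef_map.
exists (\poly_(i < size q) c i); apply/polyP => i; rewrite coef_map coef_poly.
case: ltnP => hi; first exact: hc.
by rewrite nth_default //; apply: rmorph0.
Qed.

Section MapFactors.
Variables (L M : fieldType) (s : {rmorphism L -> M}).

Lemma map_xpoly xs : map_poly s (xpoly xs) = xpoly (map s xs).
Proof.
rewrite /xpoly rmorph_prod big_map /=; apply: eq_bigr => q _.
by rewrite rmorphB rmorph1 /= map_polyZ map_polyX fmorphV.
Qed.

Lemma map_tpoly a b e xs :
  map_poly s (tpoly a b e xs) = tpoly (s a) (s b) (s e) (map s xs).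
Proof.
rewrite /tpoly rmorph_prod big_map /=; apply: eq_bigr => q _.
rewrite rmorphB /= map_polyX map_polyC /xtrans /= rmorphD fmorph_div rmorphB.
have -> // : s (fprime a b e) = fprime (s a) (s b) (s e).
by rewrite /fprime !(rmorphB, rmorphD, rmorphM, rmorph1).
Qed.
End MapFactors.

Lemma size_xpoly (L : fieldType) (xs : seq L) : 0 \notin xs -> size (xpoly xs) = (size xs).+1.
Proof.
elim: xs => [|q xs IH]; first by rewrite /xpoly big_nil size_poly1.
rewrite inE negb_or eq_sym => /andP[q0 /IH]; rewrite /xpoly big_cons => sxs.
have s2 : size (1 - q^-1 *: 'X : {poly L}) = 2%N.
  rewrite addrC size_polyDl ?size_polyN size_scale ?invr_eq0 // size_polyX //.
  by rewrite size_poly1.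
by rewrite size_mul ?s2 ?sxs // -size_poly_gt0 ?s2 ?sxs.
Qed.

Lemma root_tpoly (L : fieldType) (a b e : L) xs z :
  root (tpoly a b e xs) z = (z \in map (xtrans a b e) xs).
Proof. by rewrite -root_prod_XsubC big_map. Qed.

Lemma coprimep_tpoly (L : fieldType) (a b e e' : L) xs :
  (forall z, root (tpoly a b e xs) z -> root (tpoly a b e' xs) z -> false) ->
  coprimep (tpoly a b e xs) (tpoly a b e' xs).
Proof.
move=> h.
have : forall t, t \in xs -> ~~ root (tpoly a b e xs) (xtrans a b e' t).
  move=> t ht; apply/negP => /h/implyP; rewrite root_tpoly.
  by rewrite map_f.
move: (tpoly a b e xs) => q {h}.
rewrite /tpoly; elim: xs => [|t ys IH] h; first by rewrite big_nil coprimep1.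
rewrite big_cons coprimepMr coprimep_XsubC h ?mem_head //.
by apply: IH => u hu; apply: h; rewrite inE hu orbT.
Qed.

(** Factor by factor: x(Q + (0, 0)) = ab/q, so a - ab/q = a (1 - b/q), and likewise with a and b
    exchanged. *)
Lemma horner_tpoly0 (L : fieldType) (a b : L) xs : 0 \notin xs ->
  (tpoly a b 0 xs).[a] = a ^+ size xs * (xpoly xs).[b] /\
  (tpoly a b 0 xs).[b] = b ^+ size xs * (xpoly xs).[a].
Proof.
rewrite /tpoly /xpoly !horner_prod.
elim: xs => [|q xs IH]; first by rewrite !big_nil expr0 mulr1.
rewrite inE negb_or eq_sym => /andP[q0 /IH[ea eb]]; rewrite !big_cons ea eb /= !exprS.
by rewrite !hornerE /= /xtrans /fprime !subr0; split; field; rewrite q0.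
Qed.

Section GaloisAction.
Variables (K : fieldType) (L : closedFieldType) (iota : {rmorphism K -> L}).
Variables (a b : L) (p : nat) (G S : {fset point L}).
Hypothesis hG : is_p_subgroup a b p G.
Hypothesis hS : is_half G S.
Hypothesis hGgal : galois_stable iota G.

(** An automorphism may move a point of S into -S, but this leaves the set of x-coordinates of S
    stable. *)
Lemma galois_xcoords (s : {rmorphism L -> L}) : bijective s ->
  (forall c, s (iota c) = iota c) -> perm_eq (map s (xcoords S)) (xcoords S).
Proof.
move=> sb sc; have us : uniq (map s (xcoords S)).
  by rewrite (map_inj_uniq (fmorph_inj s)) (xcoords_uniq hG hS).
apply: uniq_perm => //; first exact: (xcoords_uniq hG hS).
apply: (uniq_min_size us _ _).2; last by rewrite [leqRHS]size_map.
move=> _ /mapP[q /(xcoords_exists hS)[r QG] ->].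
apply: (mem_xcoords hS (y := s r)); rewrite -(hGgal sb sc).
by apply/imfsetP; exists (Some (q, r)).
Qed.

Lemma galois_xpoly (s : {rmorphism L -> L}) : bijective s ->
  (forall c, s (iota c) = iota c) -> map_poly s (xpoly (xcoords S)) = xpoly (xcoords S).
Proof.
by move=> sb sc; rewrite map_xpoly /xpoly (perm_big _ (galois_xcoords sb sc)).
Qed.

Lemma galois_tpoly (s : {rmorphism L -> L}) e : bijective s ->
  (forall c, s (iota c) = iota c) -> s a = a -> s b = b -> s e = e ->
  map_poly s (tpoly a b e (xcoords S)) = tpoly a b e (xcoords S).
Proof.
move=> sb sc sa sb' se.
by rewrite map_tpoly sa sb' se /tpoly (perm_big _ (galois_xcoords sb sc)).
Qed.
End GaloisAction.

Lemma hpoly_xpoly (L : closedFieldType) (S : {fset point L}) :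
  hpoly S = xpoly (xcoords S).
Proof. by rewrite /hpoly /xpoly big_map. Qed.

Lemma gpoly_tpoly (L : closedFieldType) (a b : L) p (G S : {fset point L}) i :
  is_p_subgroup a b p G -> is_half G S ->
  (forall x y, Some (x, y) \in G -> x \notin [:: 0; a; b]) ->
  gpoly a b S i = tpoly a b [:: 0; a; b]`_i (xcoords S).
Proof.
move=> hG hS hx; rewrite /gpoly /tpoly big_map big_seq [RHS]big_seq.
have ei : [:: 0; a; b]`_i \in [:: 0; a; b] by rewrite mem_nth.
apply: eq_bigr => Q /(half_mem hS)[q [r [-> QG _]]].
rewrite xcoord_add_two_torsion //; last exact: (subgroup_on_curve hG QG).
by apply: contraNneq (hx _ _ QG) => ->.
Qed.

Lemma prod_ord3 (R : comNzRingType) (F : 'I_3 -> R) :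
  \prod_i F i = F ord0 * F (inord 1) * F (inord 2).
Proof.
rewrite !big_ord_recl big_ord0 mulr1 mulrA.
by congr (_ * F _ * F _); apply: val_inj; rewrite /= inordK.
Qed.

Section IsogenyMap.
Variables (L : fieldType) (h : {poly L}) (g : 'I_3 -> {poly L}).

Definition isogeny_map (Q : point L) : point L :=
  if Q is Some (x, y) then
    if root h x then None
    else Some (x * (g ord0).[x] ^+ 2 / h.[x] ^+ 2,
               (\prod_i (g i).[x]) / h.[x] ^+ 3 * y)
  else None.

Lemma isogeny_map_on_curve a b a' b' Q :
  'X * g ord0 ^+ 2 - a' *: h ^+ 2 = ('X - a%:P) * g (inord 1) ^+ 2 ->
  'X * g ord0 ^+ 2 - b' *: h ^+ 2 = ('X - b%:P) * g (inord 2) ^+ 2 ->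
  on_curve a b Q -> on_curve a' b' (isogeny_map Q).
Proof.
move=> ea eb; case: Q => [[x y]|//] /= hxy; case: ifPn => // hx /=; rewrite rootE in hx.
have {}ea : x * (g ord0).[x] ^+ 2 - a' * h.[x] ^+ 2 = (x - a) * (g (inord 1)).[x] ^+ 2.
  by have := congr1 (horner^~ x) ea; rewrite !(hornerE, horner_exp).
have {}eb : x * (g ord0).[x] ^+ 2 - b' * h.[x] ^+ 2 = (x - b) * (g (inord 2)).[x] ^+ 2.
  by have := congr1 (horner^~ x) eb; rewrite !(hornerE, horner_exp).
have -> : x * (g ord0).[x] ^+ 2 / h.[x] ^+ 2 - a' =
    (x - a) * (g (inord 1)).[x] ^+ 2 / h.[x] ^+ 2 by rewrite -ea; field.
have -> : x * (g ord0).[x] ^+ 2 / h.[x] ^+ 2 - b' =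
    (x - b) * (g (inord 2)).[x] ^+ 2 / h.[x] ^+ 2 by rewrite -eb; field.
by rewrite prod_ord3 exprMn hxy; field.
Qed.
End IsogenyMap.

Section TripleRepresents.
Variables (A : comNzRingType) (a b : A) (n : nat).
Variables (h : {poly A}) (g : 'I_3 -> {poly A}).
Hypothesis n0 : (0 < n)%N.
Hypothesis sh : (size h <= n.+1)%N.
Hypotheses (mg : forall i, g i \is monic) (sg : forall i, size (g i) = n.+1).
Variables (L : fieldType) (f : {rmorphism A -> L}).

Local Notation T := (isogeny_triple a b n h g).
Local Notation hL := (map_poly f h).
Local Notation gL := (fun i => map_poly f (g i)).

Hypothesis y_neq0 : forall x y, on_curve (f a) (f b) (Some (x, y)) -> root hL x ->
  y != 0 /\ forall i, ~~ root (gL i) x.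

(** One triple serves at every point: at a root of h the outer two forms vanish and the middle one,
    y times the product of the g_i, does not, which gives [0 : 1 : 0]. *)
Lemma isogeny_triple_cases P : on_curve (f a) (f b) P ->
  exists2 c, c != 0 & forall i, eval_at f T P i = c * proj_coords (isogeny_map hL gL P) i.
Proof.
case: P => [[x y]|] hP; last first.
  by exists 1 => [|i]; rewrite ?oner_neq0 // isogeny_triple_infinity // mul1r.
have [rx|nrx] := boolP (root hL x).
  have [y0 gx] := y_neq0 hP rx.
  exists (y * \prod_i (map_poly f (g i)).[x]).
    by rewrite mulf_neq0 //; apply/prodf_neq0 => i _; apply: gx.
  move=> i; rewrite isogeny_triple_affine //= rx (eqP rx).
  by have [] := ord3P i => ->; rewrite /= inordK //= ?mulr0 ?mulr1 ?expr0n.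
have hx : hL.[x] != 0 by [].
exists (hL.[x] ^+ 3); first by rewrite expf_neq0.
move=> i; rewrite isogeny_triple_affine //= (negbTE nrx).
by have [] := ord3P i => ->; rewrite /= inordK //=; field.
Qed.

Lemma isogeny_triple_represents : represents f (f a) (f b) (isogeny_map hL gL) T.
Proof. by move=> P hP _; apply: isogeny_triple_cases. Qed.

Lemma isogeny_triple_defined P : on_curve (f a) (f b) P -> defined_at f T P.
Proof.
move=> /isogeny_triple_cases[c c0 hc].
case: (isogeny_map hL gL P) hc => [[x y]|] hc.
  by exists (inord 2); rewrite hc /= inordK //= mulr1.
by exists (inord 1); rewrite hc /= inordK //= mulr1.
Qed.
End TripleRepresents.

Section TripleFrobenius.
Variables (A : comNzRingType) (a b : A) (n : nat).
Variables (h : {poly A}) (g : 'I_3 -> {poly A}).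
Hypothesis n0 : (0 < n)%N.
Hypothesis sh : (size h <= n.+1)%N.
Hypotheses (mg : forall i, g i \is monic) (sg : forall i, size (g i) = n.+1).
Variables (L : fieldType) (f : {rmorphism A -> L}).
Hypothesis hL : map_poly f h = 1.
Hypothesis gL : forall i, map_poly f (g i) = ('X - ([:: 0; f a; f b]`_i)%:P) ^+ n.

Local Notation T := (isogeny_triple a b n h g).

(** Here the product of the g_i is (x (x - a) (x - b))^n = y^(2n) on the curve, and x g_1^2 = x^(2n
    + 1). *)
Lemma isogeny_triple_frobenius P i : on_curve (f a) (f b) P ->
  eval_at f T P i = proj_coords (frobenius (2 * n).+1 P) i.
Proof.
case: P => [[x y]|] hP; last by rewrite isogeny_triple_infinity.
rewrite isogeny_triple_affine // hL prod_ord3 !gL /= !inordK //=.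
rewrite !(horner_exp, hornerE) /=.
have [] := ord3P i => ->; rewrite /= inordK //= ?expr1n //.
  by rewrite subr0 -mulrA -exprD -exprS addnn mul2n.
have -> : y * (x - 0) ^+ n * (x - f a) ^+ n * (x - f b) ^+ n =
    y * (x * (x - f a) * (x - f b)) ^+ n by rewrite subr0 !exprMn !mulrA.
by rewrite -hP -exprM -exprS.
Qed.

Lemma frobenius_represented : represents f (f a) (f b) (@frobenius (2 * n).+1 L) T.
Proof.
move=> P hP _; exists 1; first exact: oner_neq0.
by move=> i; rewrite isogeny_triple_frobenius // mul1r.
Qed.

Lemma frobenius_defined P : on_curve (f a) (f b) P -> defined_at f T P.
Proof.
move=> hP; case e: (frobenius (2 * n).+1 P) => [[x y]|].
  by exists (inord 2); rewrite isogeny_triple_frobenius // e /= inordK //= oner_neq0.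
by exists (inord 1); rewrite isogeny_triple_frobenius // e /= inordK //= oner_neq0.
Qed.
End TripleFrobenius.

(** * Models of h and g_i over R, and their reduction *)

Section LiftOfFrobenius.
Variables (R : idomainType) (pi : R) (k : fieldType) (red : {rmorphism R -> k}).
Variables (p : nat) (L : closedFieldType).
Variables (iota : {rmorphism {fraction R} -> L}) (v : L -> rat).
Variables (a b : R) (G S : {fset point L}).
Local Notation f := (iota \o @tofrac R).
Local Notation A := (iota (tofrac a)).
Local Notation B := (iota (tofrac b)).
Hypothesis hdvr : is_dvr pi.
Hypothesis hres : is_residue_map pi red.
Hypothesis hp : p \in [pchar k].
Hypothesis hp2 : (2 < p)%N.
Hypothesis hchar0 : [pchar {fraction R}] =i pred0.
Hypothesis hclosure : is_algebraic_closure iota.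
Hypothesis hv : is_valuation_extension pi (fun r : R => iota (tofrac r)) v.
Hypotheses (ha : a \is a GRing.unit) (hb : b \is a GRing.unit).
Hypothesis hab : ~ rdvd pi (a - b).
Hypothesis hG : is_p_subgroup A B p G.
Hypothesis hGgal : galois_stable iota G.
Hypothesis hGker : forall Q, Q \in G -> in_kernel_of_reduction v Q.
Hypothesis hS : is_half G S.

Local Notation xs := (xcoords S).
Local Notation n := (size (xcoords S)).

Definition rootR (i : 'I_3) : R := [:: 0; a; b]`_i.

Lemma rootL (i : 'I_3) : [:: 0; A; B]`_i = iota (tofrac (rootR i)).
Proof. by have [] := ord3P i => ->; rewrite /rootR /= inordK //= !rmorph0. Qed.

Lemma rootk (M : fieldType) (h : {rmorphism R -> M}) i :
  h (rootR i) = [:: 0; h a; h b]`_i.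
Proof. by have [] := ord3P i => ->; rewrite /rootR /= inordK //= !rmorph0. Qed.

Lemma vint_root i : vint v (iota (tofrac (rootR i))).
Proof. exact: (vint_base hdvr hv). Qed.

Lemma red_a_neq0 : red a != 0.
Proof. by rewrite -unitfE rmorph_unit. Qed.

Lemma red_b_neq0 : red b != 0.
Proof. by rewrite -unitfE rmorph_unit. Qed.

Lemma red_a_neq_b : red a != red b.
Proof.
rewrite -subr_eq0 -rmorphB; apply/eqP => h; apply: hab.
by case: hres => _ hr; apply/hr.
Qed.

Lemma vmax_root_sub i j : vmax v (iota (tofrac (rootR i)) - iota (tofrac (rootR j))) -> i = j.
Proof.
rewrite -!rmorphB => /(vmax_red hdvr hres hv) /eqP.
rewrite rmorphB subr_eq0 !rootk; have := red_a_neq_b; have := red_a_neq0; have := red_b_neq0.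
have [] := ord3P i => ->; have [] := ord3P j => ->; rewrite !inordK //=;
  by rewrite ?[0 == _]eq_sym ?[red b == _]eq_sym => /negbTE b0 /negbTE a0 /negbTE ab;
     rewrite ?a0 ?b0 ?ab.
Qed.

Lemma two_neq0_fraction : (2 : {fraction R}) != 0.
Proof. by rewrite (GRing.pcharf0P _).1. Qed.

Lemma two_neq0_closure : (2 : L) != 0.
Proof. by rewrite -(rmorph_nat iota) fmorph_eq0 two_neq0_fraction. Qed.

Lemma kernel_x_neg x y : Some (x, y) \in G -> x != 0 /\ v x < 0.
Proof. by move=> /hGker. Qed.

Lemma kernel_x_notin x y : Some (x, y) \in G -> x \notin [:: 0; A; B].
Proof.
move=> /kernel_x_neg[x0 vx]; have := vint_neg x0 vx; apply: contraFN.
by move=> /(nthP 0)[i hi <-]; rewrite (rootL (Ordinal hi)) vint_root.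
Qed.

Lemma xcoords_neg q : q \in xs -> q != 0 /\ v q < 0.
Proof. by move=> /(xcoords_exists hS)[y /kernel_x_neg]. Qed.

Lemma zero_notin : 0 \notin xs.
Proof. by apply/negP => /xcoords_neg[]; rewrite eqxx. Qed.

Lemma p_eq : p = (2 * n).+1.
Proof. by rewrite (subgroup_card hG hS) mul2n. Qed.

Lemma half_size_gt0 : (0 < n)%N.
Proof. by move: hp2; rewrite p_eq; case: (n). Qed.

Local Notation hL := (xpoly xs).
Local Notation gL i := (tpoly A B (iota (tofrac (rootR i))) xs).

Lemma gpolyE i : gpoly A B S i = gL i.
Proof. by rewrite (gpoly_tpoly i hG hS kernel_x_notin) rootL. Qed.

Lemma h_descent : exists hR : {poly R}, map_poly f hR = hL /\ map_poly red hR = 1.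
Proof.
have [hK eK] : exists hK, map_poly iota hK = hL.
  apply: (poly_descent hclosure hchar0) => s sb sc.
  exact: (galois_xpoly hG hS hGgal sb sc).
have hc := pcong_xpoly hv xcoords_neg.
have [hR eR] : exists hR, map_poly (@tofrac R) hR = hK.
  by apply: (pint_descent hdvr hv); rewrite eK; apply: (pint_pcong hv hc (pint1 hv)).
exists hR; have e : map_poly f hR = hL by rewrite map_poly_comp -eK -eR.
split=> //; rewrite -(rmorph1 (map_poly red)).
by apply: (pcong_red hdvr hres hv); rewrite e rmorph1.
Qed.

Lemma g_descent i : exists gR : {poly R}, map_poly f gR = gL i /\
  map_poly red gR = ('X - (red (rootR i))%:P) ^+ n.
Proof.
have [gK eK] : exists gK, map_poly iota gK = gL i.
  apply: (poly_descent hclosure hchar0) => s sb sc.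
  by apply: (galois_tpoly hG hS hGgal sb sc).
have hc := pcong_tpoly hdvr hv xcoords_neg
  (vint_base hdvr hv a) (vint_base hdvr hv b) (vint_root i).
have ig := pint_pcong hv hc (pintX hv n (pint_XsubC hv (vint_root i))).
have [gR eR] : exists gR, map_poly (@tofrac R) gR = gK.
  by apply: (pint_descent hdvr hv); rewrite eK.
exists gR; have e : map_poly f gR = gL i by rewrite map_poly_comp -eK -eR.
split=> //; have -> : ('X - (red (rootR i))%:P) ^+ n =
    map_poly red (('X - (rootR i)%:P) ^+ n).
  by rewrite rmorphXn rmorphB /= map_polyX map_polyC.
apply: (pcong_red hdvr hres hv); rewrite e.
by rewrite rmorphXn rmorphB /= map_polyX map_polyC.
Qed.

Lemma root_g_residue i z : root (gL i) z -> vmax v (z - iota (tofrac (rootR i))).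
Proof.
rewrite root_tpoly => /mapP[q qxs ->]; have [q0 vq] := xcoords_neg qxs.
by apply: (vmax_xtrans hdvr hv) => //; first [exact: vint_root | exact: (vint_base hdvr hv)].
Qed.

Lemma coprime_g i j : i != j -> coprimep (gL i) (gL j).
Proof.
move=> nij; apply: coprimep_tpoly => z /root_g_residue hi /root_g_residue hj.
have := vmaxB hv hj hi.
rewrite opprB [_ + (_ - z)]addrC addrA subrK => /vmax_root_sub.
by move=> e; rewrite e eqxx in nij.
Qed.

(** A root of h has negative valuation, whereas the roots of the g_i are integral; y is nonzero
    because G has no point of order two. *)
Lemma root_h_nonvanishing x y : on_curve A B (Some (x, y)) -> root hL x ->
  y != 0 /\ forall i, ~~ root (gL i) x.
Proof.
move=> hxy; rewrite (root_xpoly _ zero_notin) => xin; split.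
  apply: (subgroup_y_neq0 hG kernel_x_notin); exact: (xcoords_mem hG hS xin hxy).
move=> i; apply/negP => /root_g_residue hi; have [x0 vx] := xcoords_neg xin.
have : vint v x = false by apply: vint_neg.
by rewrite -[x](subrK (iota (tofrac (rootR i)))) (vintD hv) ?vint_root // vmaxW.
Qed.

Lemma embed_inj : injective f.
Proof. by move=> x y /(fmorph_inj iota)/eqP; rewrite tofrac_eq => /eqP. Qed.

(** The same polynomials over R give the isogeny on the generic fibre and Frobenius on the special
    one; degrees and monicity descend along the injection of R. *)
Lemma integral_model : exists (hR : {poly R}) (gR : 'I_3 -> {poly R}),
  [/\ map_poly f hR = hL, map_poly red hR = 1, size hR = n.+1
    & forall i, [/\ map_poly f (gR i) = gL i, gR i \is monic, size (gR i) = n.+1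
      & map_poly red (gR i) = ('X - ([:: 0; red a; red b]`_i)%:P) ^+ n]].
Proof.
have [hR [ehR rhR]] := h_descent; have /boolp.choice[gR hgR] := g_descent.
have f0 : f 0 = 0 by rewrite rmorph0.
exists hR, gR; split=> // [|i].
  by rewrite -(size_map_inj_poly embed_inj f0) ehR size_xpoly // zero_notin.
have [eg rg] := hgR i; split=> //; last by rewrite rg rootk.
  rewrite monicE; apply/eqP/embed_inj.
  rewrite -(lead_coef_map_inj embed_inj f0) eg rmorph1.
  exact/monicP/monic_tpoly.
by rewrite -(size_map_inj_poly embed_inj f0) eg size_tpoly.
Qed.

Lemma g_identity_a : 'X * gL ord0 ^+ 2 -
    (A ^+ p * (hL.[B] / hL.[A]) ^+ 2) *: hL ^+ 2 = ('X - A%:P) * gL (inord 1) ^+ 2.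
Proof.
have := translate_identity two_neq0_closure hG hS kernel_x_notin (e := A).
rewrite /rootR /= inordK //= !rmorph0 => <-; last by rewrite !inE eqxx orbT.
rewrite (horner_tpoly0 A B zero_notin).1; congr (_ - _ *: _).
by rewrite p_eq expr_div_n exprMn exprS mulnC exprM !mulrA.
Qed.

Lemma g_identity_b : 'X * gL ord0 ^+ 2 -
    (B ^+ p * (hL.[A] / hL.[B]) ^+ 2) *: hL ^+ 2 = ('X - B%:P) * gL (inord 2) ^+ 2.
Proof.
have := translate_identity two_neq0_closure hG hS kernel_x_notin (e := B).
rewrite /rootR /= inordK //= !rmorph0 => <-; last by rewrite !inE eqxx !orbT.
rewrite (horner_tpoly0 A B zero_notin).2; congr (_ - _ *: _).
by rewrite p_eq expr_div_n exprMn exprS mulnC exprM !mulrA.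
Qed.

Lemma g_pullback_identity :
  ('X * gL ord0 ^+ 2)^`() * hL - 2 *: ('X * gL ord0 ^+ 2 * hL^`()) =
  lead_coef hL *: \prod_i gL i.
Proof.
have ne i j : (i < 3)%N -> (j < 3)%N -> i != j -> (inord i : 'I_3) != inord j.
  by move=> hi hj; rewrite -val_eqE /= !inordK.
have e0 : ord0 = inord 0 :> 'I_3 by apply: val_inj; rewrite /= inordK.
rewrite prod_ord3; apply: (pullback_identity (n := n) _ _ _ _ _ _ _ _ _ _
    g_identity_a g_identity_b); rewrite ?monic_tpoly ?size_tpoly //.
- by rewrite size_xpoly // zero_notin.
- by apply: coprime_g; rewrite e0 ne.
- by apply: coprime_g; rewrite e0 ne.
- by apply: coprime_g; rewrite ne.
Qed.

Lemma isogeny_map_kernel Q : on_curve A B Q ->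
  (isogeny_map hL (fun i => gL i) Q = None <-> Q \in G).
Proof.
case: hG => _ NG _ _ _; case: Q => [[x y]|] hQ //=.
rewrite (root_xpoly _ zero_notin); case: ifPn => xin; split=> // QG.
- exact: (xcoords_mem hG hS xin hQ).
- by case/negP: xin; apply: (mem_xcoords hS QG).
Qed.

End LiftOfFrobenius.

Theorem theorem3p1
  (R : idomainType) (pi : R) (k : fieldType) (red : {rmorphism R -> k})
  (p : nat) (Kbar : closedFieldType)
  (iota : {rmorphism {fraction R} -> Kbar}) (v : Kbar -> rat)
  (a b : R) (G S : {fset point Kbar})
  (hdvr : is_dvr pi)
  (hcomplete : is_complete pi)
  (hres : is_residue_map pi red)
  (hp : p \in [pchar k]) (hp2 : (2 < p)%N)
  (hperfect : is_perfect p k)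
  (hchar0 : [pchar {fraction R}] =i pred0)
  (hclosure : is_algebraic_closure iota)
  (hv : is_valuation_extension pi (fun r : R => iota (tofrac r)) v)
  (ha : a \is a GRing.unit) (hb : b \is a GRing.unit)
  (hab : ~ rdvd pi (a - b))
  (hG : is_p_subgroup (iota (tofrac a)) (iota (tofrac b)) p G)
  (hGgal : galois_stable iota G)
  (hGker : forall Q, Q \in G -> in_kernel_of_reduction v Q)
  (hS : is_half G S) :
  exists (h : {poly {fraction R}}) (g : 'I_3 -> {poly {fraction R}}),
    (map_poly iota h = hpoly S /\
     forall i, map_poly iota (g i) = gpoly (iota (tofrac a)) (iota (tofrac b)) S i) /\
    let ap : {fraction R} := (tofrac a) ^+ p * (h.[tofrac b] / h.[tofrac a]) ^+ 2 in
    let bp : {fraction R} := (tofrac b) ^+ p * (h.[tofrac a] / h.[tofrac b]) ^+ 2 in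
    nonsingular (iota ap) (iota bp) /\
    exists F : point Kbar -> point Kbar,
      [/\ is_isogeny iota (iota (tofrac a)) (iota (tofrac b)) (iota ap) (iota bp) F,
          forall x y : Kbar,
            on_curve (iota (tofrac a)) (iota (tofrac b)) (Some (x, y)) ->
            (map_poly iota h).[x] != 0 ->
            F (Some (x, y)) = Some (Fx_at iota h g x, Fy_at iota h g x y)
        & forall Q, on_curve (iota (tofrac a)) (iota (tofrac b)) Q ->
            (F Q = None <-> Q \in G)] /\
      [/\ exists r : R, tofrac r = ap,
          exists r : R, tofrac r = bp,
          exists q : {poly R}, map_poly (@tofrac R) q = h
        & forall i, exists q : {poly R}, map_poly (@tofrac R) q = g i] /\
      [/\ exists r : R, tofrac r = ap /\ red r = red a ^+ p,
          exists r : R, tofrac r = bp /\ red r = red b ^+ p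
        & forall (kbar : closedFieldType) (jbar : {rmorphism k -> kbar}),
            is_algebraic_closure jbar ->
            lifts (fun r : R => iota (tofrac r)) (fun r : R => jbar (red r)) a b F
              (@frobenius p kbar)] /\
      (forall (KE : fieldType) (j : {rmorphism {fraction R} -> KE}) (x y : KE)
         (Omega : lmodType KE) (d : KE -> Omega),
         is_function_field (tofrac a) (tofrac b) j x y -> is_kaehler j d ->
         pullback_dx_over_y d (Fx_at j h g x) (Fy_at j h g x y) =
         j (lead_coef h) *: (y^-1 *: d x)).
Proof.
have [hR [gR [ehR rhR shR hgR]]] :=
  integral_model hdvr hres hchar0 hclosure hv hG hGgal hGker hS.
pose xs := xcoords S; pose n := size xs.
have hpn : p = (2 * n).+1 := p_eq hG hS.
have n0 : (0 < n)%N := half_size_gt0 hp2 hG hS.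
pose A := iota (tofrac a); pose B := iota (tofrac b).
pose hL := xpoly xs; pose gL i := tpoly A B (iota (tofrac (rootR a b i))) xs.
pose hK := map_poly (@tofrac R) hR; pose gK i := map_poly (@tofrac R) (gR i).
have ehK : map_poly iota hK = hL by rewrite -map_poly_comp.
have egK i : map_poly iota (gK i) = gL i.
  by rewrite -map_poly_comp; have [] := hgR i.
have egK' : (fun i => map_poly iota (gK i)) = gL by apply: boolp.funext.
exists hK, gK; split.
  by split=> [|i]; rewrite ?ehK ?hpoly_xpoly // egK (gpolyE hdvr hv hG hGker hS).
move=> ap bp.
(* As h reduces to 1, its values on R are units, so the quotients defining a^(p) and b^(p) stay in R
   and reduce to 1. *)
have redh c : red hR.[c] = 1 by rewrite -horner_map rhR hornerC.
have uh c : hR.[c] \is a GRing.unit.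
  by apply: (red_unit hdvr hres); rewrite redh oner_neq0.
pose ra := a ^+ p * (hR.[b] / hR.[a]) ^+ 2.
pose rb := b ^+ p * (hR.[a] / hR.[b]) ^+ 2.
have era : tofrac ra = ap.
  by rewrite rmorphM !rmorphXn rmorph_div // /ap /hK !horner_map.
have erb : tofrac rb = bp.
  by rewrite rmorphM !rmorphXn rmorph_div // /bp /hK !horner_map.
have rra : red ra = red a ^+ p.
  by rewrite rmorphM !rmorphXn rmorph_div // !redh divr1 expr1n mulr1.
have rrb : red rb = red b ^+ p.
  by rewrite rmorphM !rmorphXn rmorph_div // !redh divr1 expr1n mulr1.
have neq_lift r s : red r != red s -> iota (tofrac r) != iota (tofrac s).
  by apply: contraNneq => /(fmorph_inj iota)/eqP; rewrite tofrac_eq => /eqP ->.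
have ap0 : iota ap != 0.
  have := neq_lift ra 0; rewrite era rra !rmorph0; apply.
  by rewrite expf_neq0 // red_a_neq0.
have bp0 : iota bp != 0.
  have := neq_lift rb 0; rewrite erb rrb !rmorph0; apply.
  by rewrite expf_neq0 // red_b_neq0.
have abp : iota ap != iota bp.
  have := neq_lift ra rb; rewrite era erb rra rrb; apply.
  (* Frobenius is injective on k, so the p-th powers of the residues of a and b remain distinct. *)
  rewrite -subr_eq0 -!(pFrobenius_autE hp) -rmorphB fmorph_eq0 subr_eq0.
  exact: (red_a_neq_b hres hab).
have two0 := two_neq0_closure iota hchar0.
split; first exact: weierstrass_nonsingular.
have eapL : iota ap = A ^+ p * (hL.[B] / hL.[A]) ^+ 2.
  by rewrite rmorphM !rmorphXn fmorph_div /= -ehK !horner_map.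
have ebpL : iota bp = B ^+ p * (hL.[A] / hL.[B]) ^+ 2.
  by rewrite rmorphM !rmorphXn fmorph_div /= -ehK !horner_map.
have ida := g_identity_a hdvr hchar0 hv hG hGker hS; rewrite -eapL in ida.
have idb := g_identity_b hdvr hchar0 hv hG hGker hS; rewrite -ebpL in idb.
have nonvan := root_h_nonvanishing hdvr hv hG hGker hS.
pose F := isogeny_map hL gL; exists F.
have sgR i : size (gR i) = n.+1 by have [] := hgR i.
have mgR i : gR i \is monic by have [] := hgR i.
have tf0 : @tofrac R 0 = 0 by rewrite rmorph0.
have tfi : injective (@tofrac R) by move=> r s /eqP; rewrite tofrac_eq => /eqP.
have shK : (size hK <= n.+1)%N by rewrite size_map_inj_poly // shR.
have sgK i : size (gK i) = n.+1 by rewrite size_map_inj_poly.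
have mgK i : gK i \is monic.
  by rewrite monicE lead_coef_map_inj // (monicP (mgR i)) rmorph1.
have nvK x y : on_curve A B (Some (x, y)) -> root (map_poly iota hK) x ->
    y != 0 /\ forall i, ~~ root (map_poly iota (gK i)) x.
  rewrite ehK => hxy /(nonvan _ _ hxy)[y0 gx].
  by split=> // i; rewrite egK; apply: gx.
have FK : isogeny_map (map_poly iota hK) (fun i => map_poly iota (gK i)) = F.
  by rewrite ehK egK'.
split; [split|split; [split|split; [split|]]].
- split=> //; last first.
    (* (0, 0) has an affine image because 0 is not a root of h, so the map is not constantly the
       zero point. *)
    exists (Some (0, 0)) => /=; first by rewrite !mul0r expr0n.
    by rewrite (root_xpoly _ (zero_notin hGker hS)) (negbTE (zero_notin hGker hS)).
  split=> P hP; first exact: isogeny_map_on_curve ida idb hP.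
  exists (isogeny_triple (tofrac a) (tofrac b) n hK gK); split.
  + exact: isogeny_triple_homogeneous.
  + exact: (isogeny_triple_defined n0 shK mgK sgK nvK hP).
  + by rewrite -FK; apply: (isogeny_triple_represents n0 shK mgK sgK nvK).
- move=> x y hxy hx; rewrite -FK /= rootE (negbTE hx).
  by [].
- by move=> Q hQ; apply: (isogeny_map_kernel hG hGker hS hQ).
- by exists ra.
- by exists rb.
- by exists hR.
- by move=> i; exists (gR i).
- by exists ra.
- by exists rb.
- move=> kbar jbar _ P hP; pose f : {rmorphism R -> Kbar} := iota \o @tofrac R.
  pose fk : {rmorphism R -> kbar} := jbar \o red.
  have efR : isogeny_map (map_poly f hR) (fun i => map_poly f (gR i)) = F.
    rewrite /F ehR; congr isogeny_map; apply: boolp.funext => i.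
    by have [] := hgR i.
  have nvR x y : on_curve (f a) (f b) (Some (x, y)) -> root (map_poly f hR) x ->
      y != 0 /\ forall i, ~~ root (map_poly f (gR i)) x.
    rewrite ehR => hxy /(nonvan _ _ hxy)[y0 gx].
    by split=> // i; have [-> _ _ _] := hgR i; apply: gx.
  have hk : map_poly fk hR = 1 by rewrite map_poly_comp rhR rmorph1.
  have gk i : map_poly fk (gR i) = ('X - ([:: 0; fk a; fk b]`_i)%:P) ^+ n.
    have [_ _ _ rg] := hgR i.
    rewrite map_poly_comp rg rmorphXn rmorphB /= map_polyX map_polyC /=.
    by have [] := ord3P i => ->; rewrite inordK //= ?rmorph0.
  have shR' : (size hR <= n.+1)%N by rewrite shR.
  (* This triple does not depend on the point P of the special fibre: it has no base point there. *)
  exists (isogeny_triple a b n hR gR); split.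
  + exact: isogeny_triple_homogeneous.
  + exact: (frobenius_defined n0 shR' mgR sgR hk gk hP).
  + by rewrite -efR; apply: (isogeny_triple_represents n0 shR' mgR sgR nvR).
  + by rewrite hpn; apply: (frobenius_represented n0 shR' mgR sgR hk gk).
move=> KE j x y Omega d hFF [hd _].
apply: (pullback_differential hd hFF).
- by rewrite -size_poly_gt0 size_map_inj_poly // shR.
- by move=> i; apply: monic_neq0.
have := g_pullback_identity hdvr hres hchar0 hv ha hb hab hG hGker hS.
(* The identity is known over the closure; injectivity of [map_poly iota] brings it down to K. *)
rewrite -[xpoly _]ehK => U; apply: (map_poly_inj iota).
have eN : map_poly iota ('X * gK ord0 ^+ 2) = 'X * gL ord0 ^+ 2.
  by rewrite rmorphM rmorphXn /= map_polyX egK.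
rewrite rmorphB /= !map_polyZ rmorph_nat /= rmorph_prod /=.
rewrite (rmorphM (map_poly iota) _ hK) (rmorphM (map_poly iota) _ hK^`()) /=.
rewrite -!deriv_map eN U lead_coef_map; congr (_ *: _).
by apply: eq_bigr => i _; rewrite egK.
Qed.
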